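(* For each $n$ let $V_1,\ldots,V_m$ be a partition of $[n]$ into (nonempty) communities, let $\mathbf{q}=\{q_{ab}\}_{a,b\in[m]}$ be a symmetric collection of elements of $[0,1]$, and let $s\in[0,1]$ (all, including $m$, possibly depending on $n$). Let $(G_1,G_2)$ be a pair of correlated stochastic block models with parameters $(V_1,\ldots,V_m,\mathbf{q},s)$ and latent permutation $\pi_*$. Let $q_{\max}:=\max_{a,b\in[m]}q_{ab}$ and $q_{\min}:=\min_{a,b\in[m]}q_{ab}$. Suppose that $q_{\max}=n^{-1+o(1)}$ and $k=13$, and that there exists a constant $\epsilon>0$ such that $$\min_{a\in[m]}\sum_{b=1}^m|V_b|\,q_{ab}\,s^2\ge\max\Bigl\{\frac{q_{\max}}{q_{\min}},154\Bigr\}+\epsilon .$$ Let $(\widehat M_k,\widehat\mu_k)$ be the $k$-core estimator of $(G_1,G_2)$. Then with probability $1-o(1)$ as $n\to\infty$ it holds that $$|\widehat M_k|\ge\Bigl(1-3e^{-\min_{i\in[n]}\sum_{j=1}^n p_{ij}s^2/7}\Bigr)n-o(n)\quad\text{and}\quad\widehat\mu_k\{\widehat M_k\}=\pi_*\{\widehat M_k\},$$ where $p_{ij}=q_{ab}$ for distinct $i\in V_a$, $j\in V_b$, and $p_{ii}=0$.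
   Context: Correlated stochastic block models with parameters $(V_1,\ldots,V_m,\mathbf{q},s)$: generate a simple undirected random graph $G$ on $[n]$ in which each edge $\{i,j\}$, $i\ne j$, is present with probability $p_{ij}=q_{ab}$ whenever $i\in V_a$, $j\in V_b$, independently over unordered pairs; conditionally on $G$, generate $G_1$ and $G_2'$ independently, each keeping every edge of $G$ independently with probability $s$ (same vertex set $[n]$); finally let $\pi_*$ be an independent uniformly random permutation of $[n]$ and let $G_2$ be $G_2'$ with vertices relabelled by $\pi_*$, so that $\{\pi_*(i),\pi_*(j)\}$ is an edge of $G_2$ iff $\{i,j\}$ is an edge of $G_2'$. A matching is a pair $(M,\mu)$ with $M\subseteq[n]$ and $\mu:M\to[n]$ injective. $G_1\wedge_\mu G_2$ is the graph on vertex set $M$ in which $\{i,j\}$ is an edge iff $\{i,j\}$ is an edge of $G_1$ and $\{\mu(i),\mu(j)\}$ is an edge of $G_2$. A matching is a $k$-core matching if every vertex of $G_1\wedge_\mu G_2$ has degree at least $k$ (the empty matching qualifies vacuously). The $k$-core estimator $(\widehat M_k,\widehat\mu_k)$ is a $k$-core matching of $(G_1,G_2)$ with $|M|$ as large as possible among all $k$-core matchings (ties broken arbitrarily). For a map $\mu$ and a subset $S$ of its domain, $\mu\{S\}:=\{(i,\mu(i)):i\in S\}$. $q_{\max}=n^{-1+o(1)}$ means $q_{\max}=n^{-1+\varepsilon_n}$ for some deterministic sequence $\varepsilon_n\to0$; the $o(n)$ term denotes a deterministic sequence $a_n$ with $a_n/n\to0$. The ratio $q_{\max}/q_{\min}$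 is $+\infty$ if $q_{\min}=0$ (so the hypothesis forces $q_{\min}>0$). *)

(* Defs.v *)
From mathcomp Require Import all_boot all_order all_algebra all_fingroup.
From mathcomp Require Import all_classical all_reals all_analysis.
Import Order.TTheory GRing.Theory Num.Theory.
Import numFieldNormedType.Exports.

Set Implicit Arguments.
Unset Strict Implicit.
Unset Printing Implicit Defensive.

Local Open Scope ring_scope.

(* An unordered pair of distinct vertices is encoded by its increasing
   ordering, so that a simple graph is an arbitrary set of such pairs. *)
Definition vpair (n : nat) := {e : 'I_n * 'I_n | (e.1 < e.2)%N}.

Definition sgraph (n : nat) := {set vpair n}.

Definition adj (n : nat) (G : sgraph n) (i j : 'I_n) : bool :=
  [exists e in G, (val e == (i, j)) || (val e == (j, i))].

(* {pi i, pi j} is an edge of [relabel pi G] iff {i, j} is an edge of G. *)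
Definition relabel (n : nat) (pi : {perm 'I_n}) (G : sgraph n) : sgraph n :=
  [set e : vpair n | adj G ((pi^-1)%g (val e).1) ((pi^-1)%g (val e).2)].

Section FiniteExtrema.
Context {R : realType} {I : finType}.

(* For nonempty I these are attained, as the range is finite. *)
Definition fmin (f : I -> R) : R := inf (range f).
Definition fmax (f : I -> R) : R := sup (range f).

End FiniteExtrema.

Definition community_partition (n m : nat) (V : 'I_m -> {set 'I_n}) : Prop :=
  injective V /\ finset.partition [set V a | a : 'I_m] [set: 'I_n]%SET.

Section CorrelatedSBM.
Context {R : realType} {n m : nat}.
Variables (V : 'I_m -> {set 'I_n}) (q : 'I_m -> 'I_m -> R) (s : R).

Definition qmax : R := fmax (fun ab : 'I_m * 'I_m => q ab.1 ab.2).
Definition qmin : R := fmin (fun ab : 'I_m * 'I_m => q ab.1 ab.2).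

(* When V is a partition, the double sum has the single term q a b
   with i in V a and j in V b. *)
Definition edge_prob (i j : 'I_n) : R :=
  if i == j then 0
  else \sum_(a | i \in V a) \sum_(b | j \in V b) q a b.

Definition min_community_degree : R :=
  fmin (fun a : 'I_m => \sum_(b < m) #|V b|%:R * q a b * s ^+ 2).

Definition min_vertex_degree : R :=
  fmin (fun i : 'I_n => \sum_(j < n) edge_prob i j * s ^+ 2).

Definition bern (x : R) (b : bool) : R := if b then x else 1 - x.

Definition sbm_mass (G : sgraph n) : R :=
  \prod_(e : vpair n) bern (edge_prob (val e).1 (val e).2) (e \in G).

(* Conditional probability, given G, that the subsampled graph is H. *)
Definition subsample_mass (G H : sgraph n) : R :=
  \prod_(e : vpair n) bern (if e \in G then s else 0) (e \in H).

Definition csbm_mass (G G1 G2' : sgraph n) (pi : {perm 'I_n}) : R :=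
  sbm_mass G * subsample_mass G G1 * subsample_mass G G2' * (n`!%:R)^-1.

(* Probability of an event about G_1, G_2 and the latent permutation,
   where G_2 is G_2' with its vertices relabelled. *)
Definition csbm_prob (E : sgraph n -> sgraph n -> {perm 'I_n} -> bool) : R :=
  \sum_(G : sgraph n) \sum_(G1 : sgraph n) \sum_(G2' : sgraph n)
    \sum_(pi : {perm 'I_n} | E G1 (relabel pi G2') pi) csbm_mass G G1 G2' pi.

End CorrelatedSBM.

(* A pair (M, mu); the values of mu outside M are irrelevant. *)
Definition prematching (n : nat) := ({set 'I_n} * {ffun 'I_n -> 'I_n})%type.

Definition is_matching (n : nat) (x : prematching n) : Prop :=
  {in x.1 &, injective x.2}.

Definition inter_degree (n : nat) (G1 G2 : sgraph n) (x : prematching n)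
    (i : 'I_n) : nat :=
  #|[set j in x.1 | adj G1 i j && adj G2 (x.2 i) (x.2 j)]|.

Definition kcore_matching (k n : nat) (G1 G2 : sgraph n) (x : prematching n)
    : Prop :=
  is_matching x /\ {in x.1, forall i, (k <= inter_degree G1 G2 x i)%N}.

(* The choice of maximiser, i.e. the tie-breaking rule, is arbitrary. *)
Definition kcore_estimator (k n : nat)
    (est : sgraph n -> sgraph n -> prematching n) : Prop :=
  forall G1 G2 : sgraph n,
    kcore_matching k G1 G2 (est G1 G2) /\
    forall x : prematching n,
      kcore_matching k G1 G2 x -> (#|x.1| <= #|(est G1 G2).1|)%N.

(* mu{S} *)
Definition graph_on (n : nat) (mu : 'I_n -> 'I_n) (S : {set 'I_n})
    : {set 'I_n * 'I_n} :=
  [set (i, mu i) | i in S].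

(* Main.v *)
Require Import Defs.
From mathcomp Require Import all_boot all_order all_algebra all_fingroup.
From mathcomp Require Import all_classical all_reals all_analysis.
From mathcomp Require Import ring lra.
Import Order.TTheory GRing.Theory Num.Theory.
Import numFieldNormedType.Exports.

(** There are two independent parts: no 13-core matching contains a wrong
    pair, and the correct matching has a large 13-core. Throughout,
    [x = n ^ (1/10)], so that eventually [qmax <= x ^- 9], and the error
    sequence is [a_n = x ^+ 9].

    No wrong pair. Both observed graphs are subgraphs of the parent graph [G],
    so a 13-core matching of them which errs somewhere gives, after undoing
    [pi], a partial injection [nu] moving a set [W] of [d > 0] vertices, with
    every moved vertex having at least 13 neighbours [j] for which both [i j]
    and [nu i nu j] are edges of [G] ([kcore_misalignment]). One of the 13 may
    be lost to an edge fixed by [nu]. Among the remaining [12 d] arcs, a greedy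
    choice keeps a family in which all the edges [x] and [nu x] are distinct,
    of total weight at least [4 d], where an arc weighs 2 if it lies inside [W]
    and 1 otherwise ([exists_free_arcs]). Each chosen arc costs
    [qmax ^ 2 = n ^ (-2 + o(1))]; there are at most [d n] positions for arcs of
    weight 1 and [d ^ 2] for arcs of weight 2. Summing over arc families with an
    exponential tilt ([prob_misalignment_le]) and over the at most
    ['C(n, d) * n ^ d] maps [nu] gives a convergent geometric series with ratio
    [O(n ^ (-1/5))] ([prob_misaligned_le]).

    Large core. If the largest core misses at least [t] vertices, peeling the
    intersection graph produces a set [S] of exactly [t] vertices each having at
    most 12 neighbours outside [S] ([peeling]). The number of edges
    leaving [S] has mean at least [t (D - t qmax s^2)], where [D] is the least
    expected degree, and the hypothesis [qmax / qmin <= D + O(1)] bounds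
    [n qmax s^2] by [(D + O(1)) ^ 2]. For [t] just above
    [3 e^(-D/7) n + x ^+ 9] the correction [t qmax s^2] is therefore at most 50,
    and the deviation probability, of order [e^(-D t / 2)], beats the number
    ['C(n, t) <= (e n / t) ^ t <= e^((1 + D / 7) t)] of sets
    ([prob_sparse_cut_small]). Every set inducing minimum degree 13 in the
    intersection graph is the domain of a 13-core matching that follows [pi],
    so the estimator is at least that large. *)

Set Implicit Arguments.
Unset Strict Implicit.
Unset Printing Implicit Defensive.

Local Open Scope ring_scope.

(** * Products over independent coordinates *)

Lemma sum_set_prod (R : comNzRingType) (T : finType) (f : T -> bool -> R) :
  \sum_(A : {set T}) \prod_e f e (e \in A) = \prod_e (f e true + f e false).
Proof.
rewrite bigA_distr; apply: eq_bigr => A _; apply: eq_bigr => e _.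
by case: (e \in A).
Qed.

Lemma bern_ge0 (R : realType) (x : R) b : 0 <= x <= 1 -> 0 <= bern x b.
Proof. by move=> /andP[x0 x1]; case: b => //=; rewrite subr_ge0. Qed.

Lemma sum_bern (R : realType) (x : R) : bern x true + bern x false = 1.
Proof. by rewrite /= addrC subrK. Qed.

(** Independent coordinates: those outside [K] sum to one. *)
Lemma prob_subset_bern (R : realType) (T : finType) (p : T -> R) (K : {set T}) :
  \sum_(A : {set T} | K \subset A) \prod_e bern (p e) (e \in A)
    = \prod_(e in K) p e.
Proof.
rewrite big_mkcond /=.
pose f e (b : bool) := if (e \in K) && ~~ b then 0 else bern (p e) b.
transitivity (\sum_(A : {set T}) \prod_e f e (e \in A)).
  apply: eq_bigr => A _; case: ifP => KA.
    apply: eq_bigr => e _; rewrite /f; case: ifP => // /andP[eK].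
    by rewrite (fintype.subsetP KA).
  move/negbT/fintype.subsetPn: KA => [e eK eA].
  by rewrite (bigD1 e) //= /f eK eA mul0r.
rewrite sum_set_prod (bigID (mem K)) /= [X in _ * X]big1 ?mulr1.
  by apply: eq_bigr => e eK; rewrite /f eK /= addr0.
by move=> e /negbTE eK; rewrite /f eK /= sum_bern.
Qed.

Lemma sum_set_prod1D (R : comNzRingType) (T : finType) (A : {set T}) (f : T -> R) :
  \sum_(B : {set T} | B \subset A) \prod_(x in B) f x = \prod_(x in A) (1 + f x).
Proof.
transitivity (\prod_x ((if x \in A then f x else 0) + 1)); last first.
  rewrite [RHS]big_mkcond /=; apply: eq_bigr => x _.
  by case: ifP; rewrite ?add0r // addrC.
rewrite bigA_distr /= [LHS]big_mkcond /=; apply: eq_bigr => B _.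
case: ifP => BA.
  rewrite [LHS]big_mkcond /=; apply: eq_bigr => x _.
  by case: ifP => // xB; rewrite (fintype.subsetP BA).
move/negbT/fintype.subsetPn: BA => [x xB xA].
by rewrite (bigD1 x) //= xB (negbTE xA) mul0r.
Qed.

Lemma prod1D_le_expR (R : realType) (T : finType) (A : {set T}) (f : T -> R) :
  (forall x, 0 <= f x) ->
  \prod_(x in A) (1 + f x) <= expR (\sum_(x in A) f x).
Proof.
move=> f0; rewrite expR_sum; apply: ler_prod => x _.
by rewrite expR_ge1Dx addr_ge0.
Qed.

Lemma prod1B_le_expR (R : realType) (T : finType) (P : pred T) (f : T -> R) :
  (forall x, f x <= 1) ->
  \prod_(x | P x) (1 - f x) <= expR (- \sum_(x | P x) f x).
Proof.
move=> f1; rewrite -sumrN expR_sum; apply: ler_prod => x _.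
by rewrite expR_ge1Dx subr_ge0 f1.
Qed.

(** The binomial expansion of [(1 + d / n) ^ n] contains the term
    ['C(n, d) * (d / n) ^ d], and the whole power is at most [e ^ d]. *)
Lemma bin_mul_exp_le (R : realType) (n d : nat) : (0 < n)%N ->
  'C(n, d)%:R * d%:R ^+ d <= (expR 1 * n%:R) ^+ d :> R.
Proof.
move=> n0; have n0R : 0 < n%:R :> R by rewrite ltr0n.
have [dn|nd] := leqP d n; last first.
  by rewrite bin_small // mul0r exprn_ge0 // mulr_ge0 ?expR_ge0.
rewrite exprMn -ler_pdivrMr ?exprn_gt0 // -mulrA -expr_div_n.
have y0 : 0 <= d%:R / n%:R :> R by rewrite divr_ge0.
have -> : expR 1 ^+ d = expR (d%:R / n%:R) ^+ n :> R.
  by rewrite -!expRM_natl mulr1 mulrC divfK // gt_eqF.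
apply: (@le_trans _ _ ((1 + d%:R / n%:R) ^+ n)); last first.
  by rewrite lerXn2r ?nnegrE ?expR_ge0 ?addr_ge0 // expR_ge1Dx.
rewrite exprDn (bigD1 (Ordinal (dn : (d < n.+1)%N))) //=.
rewrite expr1n mul1r [leLHS]mulr_natl lerDl sumr_ge0 //.
Qed.

(** * Adjacency and unordered pairs *)

(** Adjacency takes ordered pairs while edges are stored increasingly; both
    orientations of an edge have the same [upair]. *)
Definition upair (n : nat) (x : 'I_n * 'I_n) : 'I_n * 'I_n :=
  if (x.1 < x.2)%N then x else (x.2, x.1).

Section Adjacency.
Context {n : nat}.
Implicit Types (G : sgraph n) (i j : 'I_n) (x y : 'I_n * 'I_n).

Lemma upair_swap i j : upair (i, j) = upair (j, i).
Proof.
rewrite /upair /=; case: (ltngtP i j) => // /val_inj ->; by [].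
Qed.

Lemma upair_eq x y : upair x = upair y -> y = x \/ y = (x.2, x.1).
Proof.
case: x y => [a b] [c d]; rewrite /upair /=.
by case: ifP => _; case: ifP => _ [-> ->]; [left|right|right|left].
Qed.

Lemma upair_eqE i j i' j' :
  (upair (i, j) == upair (i', j'))
    = ((i == i') && (j == j')) || ((i == j') && (j == i')).
Proof.
apply/eqP/orP => [/upair_eq[] [-> ->]|[] /andP[/eqP-> /eqP->]]; rewrite ?eqxx //.
- by left.
- by right.
- exact: upair_swap.
Qed.

Lemma upair_val (e : vpair n) : upair (val e) = val e.
Proof. by rewrite /upair (valP e). Qed.

Lemma upair_lt x : x.1 != x.2 -> ((upair x).1 < (upair x).2)%N.
Proof.
move=> xx; rewrite /upair; case: ifP => //= /negbT.
by rewrite -leqNgt leq_eqVlt eq_sym (inj_eq val_inj) (negbTE xx).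
Qed.

Lemma adjE G i j : adj G i j = [exists e in G, val e == upair (i, j)].
Proof.
apply: eq_existsb => e; congr (_ && _).
rewrite -[in RHS](upair_val e); case: (val e) => a b.
by rewrite upair_eqE.
Qed.

Lemma adj_sym G i j : adj G i j = adj G j i.
Proof. by rewrite !adjE upair_swap. Qed.

Lemma adj_irr G i : adj G i i = false.
Proof.
rewrite /adj; apply: negbTE; apply/negP => /fintype.existsP[e /andP[_]]; rewrite orbb => /eqP ei.
by have := valP e; rewrite ei /= ltnn.
Qed.

Lemma adj_sub G G' i j : G \subset G' -> adj G i j -> adj G' i j.
Proof.
rewrite /adj => GG' /fintype.existsP[e /andP[eG ee]]; apply/fintype.existsP; exists e.
by rewrite (fintype.subsetP GG').
Qed.

Lemma adj_val G (e : vpair n) : adj G (val e).1 (val e).2 = (e \in G).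
Proof.
rewrite adjE; apply/fintype.existsP/idP => [[f /andP[fG /eqP]]|eG].
  by rewrite -surjective_pairing upair_val => /val_inj <-.
by exists e; rewrite eG -surjective_pairing upair_val eqxx.
Qed.

Lemma adj_upair G i j :
  adj G (upair (i, j)).1 (upair (i, j)).2 = adj G i j.
Proof. by rewrite /upair; case: ifP => //= _; exact: adj_sym. Qed.

Lemma adj_relabel (pi : {perm 'I_n}) G i j :
  adj (relabel pi G) i j = adj G ((pi^-1)%g i) ((pi^-1)%g j).
Proof.
have [->|ij] := eqVneq i j; first by rewrite !adj_irr.
pose e : vpair n := exist _ (upair (i, j)) (@upair_lt (i, j) ij).
rewrite -adj_upair -[upair _]/(val e) adj_val inE /= /upair.
by case: ifP => //= _; exact: adj_sym.
Qed.

Lemma adj_setI G G' i j : adj (G :&: G') i j = adj G i j && adj G' i j.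
Proof.
have [->|ij] := eqVneq i j; first by rewrite !adj_irr.
pose e : vpair n := exist _ (upair (i, j)) (@upair_lt (i, j) ij).
rewrite -(adj_upair G) -(adj_upair G') -(adj_upair (G :&: G')).
by rewrite -[upair _]/(val e) !adj_val finset.in_setI.
Qed.

End Adjacency.

(** Distinct unordered pairs are independent edges, so a family of [#|F|] of
    them is present with probability at most [qm ^ #|F|]. *)
Lemma prob_all_adj_le (R : realType) (n : nat) (p : vpair n -> R) (qm : R)
    (F : {set 'I_n * 'I_n}) :
  (forall e, 0 <= p e <= qm) ->
  {in F, forall x, x.1 != x.2} -> {in F &, injective (@upair n)} ->
  \sum_(G : sgraph n | [forall x in F, adj G x.1 x.2])
     \prod_e bern (p e) (e \in G) <= qm ^+ #|F|.
Proof.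
move=> p01 Fd Finj.
pose K : {set vpair n} := [set e | val e \in (@upair n) @: F].
have adjK (G : sgraph n) : [forall x in F, adj G x.1 x.2] = (K \subset G).
  apply/forall_inP/fintype.subsetP => [GF e|KG x xF].
    rewrite inE => /imsetP[x xF xe]; rewrite -adj_val xe.
    by case: x xF xe => i j xF _; rewrite adj_upair; exact: (GF _ xF).
  pose e : vpair n := exist _ (upair x) (upair_lt (Fd x xF)).
  have : e \in G by apply: KG; rewrite inE /= imset_f.
  by rewrite -adj_val /= (surjective_pairing x) adj_upair.
have <- : #|K| = #|F|.
  rewrite -(card_in_imset Finj) -(card_imset _ val_inj).
  apply: eq_card => z; apply/imsetP/imsetP => [[e]|[x xF ->]].
    by rewrite inE => /imsetP[x xF xe] ->; exists x.
  by exists (exist _ (upair x) (upair_lt (Fd x xF))); rewrite ?inE /= ?imset_f.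
rewrite (eq_bigl _ _ adjK) prob_subset_bern -prodr_const.
exact: ler_prod.
Qed.

(** * Wrong core matchings leave many doubled edges *)

Section Misalignment.
Context {n : nat}.
Implicit Types (nu : {ffun 'I_n -> 'I_n}) (G : sgraph n) (x y : 'I_n * 'I_n).

Definition displaced nu : {set 'I_n} := [set i | nu i != i].

(** A vertex fixed by [nu] which is also the image of a displaced one cannot be
    matched to itself together with the latter; without these vertices [nu] is
    injective. *)
Definition aligned_dom nu : {set 'I_n} :=
  [set j | (j \in displaced nu) || (j \notin nu @: displaced nu)].

Definition pair_map nu x : 'I_n * 'I_n := (nu x.1, nu x.2).

Definition inj_displaced nu : bool :=
  [forall i in displaced nu, forall j in displaced nu, (nu i == nu j) ==> (i == j)].

(** The trace that a wrong [k]-core matching leaves on the parent graph alone,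
    with [nu] the matching read relative to the truth. *)
Definition misalignment (k : nat) nu G : bool :=
  [&& displaced nu != finset.set0, inj_displaced nu &
      [forall i in displaced nu,
        (k <= #|[set j in aligned_dom nu | adj G i j && adj G (nu i) (nu j)]|)%N]].

Definition arcs nu : {set 'I_n * 'I_n} :=
  [set x | [&& x.1 \in displaced nu, x.2 \in aligned_dom nu & x.1 != x.2]].

Definition kept_arcs nu G : {set 'I_n * 'I_n} :=
  [set x in arcs nu | [&& adj G x.1 x.2, adj G (nu x.1) (nu x.2) &
                          ~~ ((nu x.1 == x.2) && (nu x.2 == x.1))]].

(** For such a family the [2 * #|F|] edges [x] and [nu x], [x] in [F], are
    pairwise distinct, hence independent. *)
Definition free_arcs nu (F : {set 'I_n * 'I_n}) : bool :=
  [forall x in F, forall y in F,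
    (upair (pair_map nu x) != upair y) && ((upair x == upair y) ==> (x == y))].

(** Arcs inside the displaced set are rarer, having [d ^ 2] positions instead of
    [d * n], but occur in both orientations and so conflict with twice as
    many arcs. *)
Definition arc_weight nu x : nat := if x.2 \in displaced nu then 2 else 1.

Lemma aligned_dom_inj nu : inj_displaced nu -> {in aligned_dom nu &, injective nu}.
Proof.
move=> nuW; have aux i j : i \in displaced nu -> j \notin displaced nu ->
    j \in aligned_dom nu -> nu i <> nu j.
  move=> iW jW; rewrite inE (negbTE jW) /= => /negP jN ij; apply: jN.
  move: jW; rewrite inE negbK => /eqP <-; rewrite -ij; exact: imset_f.
move=> i j iD jD ij.
have [iW|iW] := boolP (i \in displaced nu); have [jW|jW] := boolP (j \in displaced nu).
- move/forall_inP/(_ i iW)/forall_inP/(_ j jW)/implyP: nuW => /(_ _)/eqP; apply.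
  exact/eqP.
- by case: (aux _ _ iW jW jD).
- by case: (aux _ _ jW iW iD).
- by move: iW jW ij; rewrite !inE !negbK => /eqP -> /eqP ->.
Qed.

Lemma arcs_domP nu x : x \in arcs nu ->
  [/\ x.1 \in displaced nu, x.1 \in aligned_dom nu, x.2 \in aligned_dom nu & x.1 != x.2].
Proof.
by rewrite inE => /and3P[x1 x2 xx]; split=> //; rewrite inE x1.
Qed.

Lemma pair_map_inj nu : inj_displaced nu -> {in arcs nu &, injective (pair_map nu)}.
Proof.
move=> nuW [a b] [c d] /arcs_domP[/= _ aD bD _] /arcs_domP[/= _ cD dD _].
by case=> /(aligned_dom_inj nuW aD cD) -> /(aligned_dom_inj nuW bD dD) ->.
Qed.

Lemma upair_pair_map_eq nu x y : inj_displaced nu -> x \in arcs nu -> y \in arcs nu ->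
  upair (pair_map nu x) = upair (pair_map nu y) -> upair x = upair y.
Proof.
case: x y => [a b] [c d] nuW /arcs_domP[/= _ aD bD _] /arcs_domP[/= _ cD dD _].
have I := aligned_dom_inj nuW.
move=> /eqP; rewrite /pair_map /= upair_eqE => /orP[] /andP[/eqP e1 /eqP e2].
  by rewrite (I _ _ aD cD e1) (I _ _ bD dD e2).
by rewrite (I _ _ aD dD e1) (I _ _ bD cD e2) upair_swap.
Qed.

(** A displaced vertex [i] loses at most one arc, the one towards [nu i]: no
    other edge at [i] can be mapped to itself by [nu]. *)
Lemma card_kept_arcs k nu G : misalignment k.+1 nu G ->
  (k * #|displaced nu| <= #|kept_arcs nu G|)%N.
Proof.
case/and3P=> _ _ /forall_inP deg.
have -> : #|kept_arcs nu G| =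
    (\sum_(i in displaced nu) #|[set j | (i, j) \in kept_arcs nu G]|)%N.
  rewrite -sum1_card (eq_bigl (fun x => (x.1 \in displaced nu) &&
     (x.2 \in [set j | (x.1, j) \in kept_arcs nu G]))); last first.
    move=> [i j] /=; rewrite [X in _ && X]inE andb_idl //.
    by rewrite inE => /andP[/arcs_domP[]].
  rewrite -(pair_big_dep (fun i => i \in displaced nu)
     (fun i j => j \in [set j | (i, j) \in kept_arcs nu G]) (fun _ _ => 1%N)) /=.
  by apply: eq_bigr => i _; rewrite sum1_card.
rewrite mulnC -sum_nat_const; apply: leq_sum => i iW.
rewrite -ltnS; apply: leq_trans (deg i iW) _.
rewrite -[leqRHS]add1n -(cards1 (nu i)).
apply: leq_trans (leq_card_setU _ _); apply: subset_leq_card.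
apply/fintype.subsetP => j; rewrite inE => /andP[jD /andP[aij anij]].
have [->|ji] := eqVneq j (nu i); first by rewrite !inE eqxx.
rewrite inE; apply/orP; right; rewrite inE [_ \in kept_arcs _ _]inE /=.
rewrite aij anij [nu i == j]eq_sym (negbTE ji) andbT inE /= iW jD /=.
by apply: contraTneq aij => <-; rewrite adj_irr.
Qed.

Definition conflicts nu (F : {set 'I_n * 'I_n}) x : {set 'I_n * 'I_n} :=
  [set y in F | [|| upair y == upair x, upair y == upair (pair_map nu x)
                  | upair (pair_map nu y) == upair x]].

Lemma card_preim_le (F Z : {set 'I_n * 'I_n}) (g : 'I_n * 'I_n -> 'I_n * 'I_n) :
  {in F &, injective g} -> (#|[set y in F | g y \in Z]| <= #|Z|)%N.
Proof.
move=> gI; rewrite -(@card_in_imset _ _ g); last first.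
  by move=> y z; rewrite !inE => /andP[yF _] /andP[zF _]; exact: gI.
apply: subset_leq_card; apply/fintype.subsetP => z /imsetP[y].
by rewrite inE => /andP[_ yZ] ->.
Qed.

(** An arc leaving the displaced set meets only arcs of the same orientation,
    whence one arc of each of the three kinds; otherwise both orientations
    count. *)
Lemma card_conflicts nu (F : {set 'I_n * 'I_n}) x :
  inj_displaced nu -> F \subset arcs nu -> x \in F ->
  (#|conflicts nu F x| <= 3 * arc_weight nu x)%N.
Proof.
move=> nuW /fintype.subsetP FA xF.
pose swp (z : 'I_n * 'I_n) : {set 'I_n * 'I_n} :=
  if x.2 \in displaced nu then [set z; (z.2, z.1)] else [set z].
have swpw z : (#|swp z| <= arc_weight nu x)%N.
  rewrite /swp /arc_weight; case: ifP => _; last by rewrite cards1.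
  by rewrite cards2; case: eqP.
have ext : x.2 \notin displaced nu -> nu x.2 = x.2 /\ x.2 \notin nu @: displaced nu.
  move=> x2; have [_ _ + _] := arcs_domP (FA x xF).
  by rewrite inE (negbTE x2) /=; split => //; apply/eqP; rewrite inE negbK in x2.
have gI : {in F &, injective (pair_map nu)}.
  by move=> y z yF zF; apply: pair_map_inj => //; exact: FA.
have idI : {in F &, injective (@id ('I_n * 'I_n))} by [].
pose U1 := [set y in F | id y \in swp x].
pose U2 := [set y in F | id y \in swp (pair_map nu x)].
pose U3 := [set y in F | pair_map nu y \in swp x].
have sub : conflicts nu F x \subset (U1 :|: U2 :|: U3)%SET.
  apply/fintype.subsetP => y; rewrite inE => /andP[yF].
  have [y1 _ _ _] := arcs_domP (FA y yF).
  case/or3P => /eqP /esym /upair_eq E; rewrite /U1 /U2 /U3 !inE yF /= /swp.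
  - case: ifPn => [x2|x2].
      by case: E => ->; rewrite !inE eqxx ?orbT.
    by case: E y1 => -> /=; rewrite ?(negbTE x2) ?inE ?eqxx.
  - case: ifPn => [x2|x2].
      by case: E => ->; rewrite !inE eqxx ?orbT.
    case: E y1 => -> /=; rewrite ?inE ?eqxx ?orbT //.
    by rewrite (ext x2).1 (ext x2).1 eqxx.
  - case: ifPn => [x2|x2].
      by case: E => ->; rewrite !inE eqxx ?orbT.
    case: E => [->|E]; first by rewrite !inE eqxx ?orbT.
    move: (ext x2).2 => /imsetP[]; exists y.1 => //.
    by move: E; rewrite /pair_map; case: (x) => a b [-> _].
apply: leq_trans (subset_leq_card sub) _.
apply: leq_trans (leq_card_setU _ _) _; rewrite mulSn addnC leq_add //.
  exact: leq_trans (card_preim_le _ gI) (swpw _).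
apply: leq_trans (leq_card_setU _ _) _; rewrite mul2n -addnn leq_add //;
  exact: leq_trans (card_preim_le _ idI) (swpw _).
Qed.

(** Greedy choice: in a maximal conflict-free family every kept arc
    conflicts with a chosen one. *)
Lemma exists_free_arcs nu G : inj_displaced nu ->
  exists2 F : {set 'I_n * 'I_n}, (F \subset kept_arcs nu G) && free_arcs nu F
    & (#|kept_arcs nu G| <= 3 * \sum_(x in F) arc_weight nu x)%N.
Proof.
move=> nuW; set K := kept_arcs nu G.
pose P (F : {set 'I_n * 'I_n}) := (F \subset K) && free_arcs nu F.
have P0 : P finset.set0.
  by rewrite /P finset.sub0set; apply/forall_inP => x; rewrite inE.
have [F /maxsetP[PF Fmax] _] := maxset_exists P0.
exists F => //; case/andP: PF => FK /forall_inP Ffree.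
have KA : K \subset arcs nu by apply/fintype.subsetP => x; rewrite inE => /andP[].
have selfc y : y \in K -> upair (pair_map nu y) != upair y.
  rewrite inE => /andP[/arcs_domP[yW _ _ _] /and3P[_ _]].
  apply: contraNneq => /esym /upair_eq; case: y yW => a b aW [] [Ea Eb] /=.
    by move: aW; rewrite inE /= Ea eqxx.
  by rewrite Ea Eb !eqxx.
have cover y : y \in K -> exists2 x, x \in F & y \in conflicts nu K x.
  move=> yK; have [yF|yF] := boolP (y \in F).
    by exists y => //; rewrite inE yK eqxx.
  have : ~~ P (y |: F).
    apply/negP => /Fmax/(_ (finset.subsetUr _ _)) E.
    by move: yF; rewrite -E !inE eqxx.
  rewrite /P finset.subUset finset.sub1set yK FK /= => /forall_inPn[u uF].
  case/forall_inPn => v vF.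
  rewrite negb_and negbK negb_imply => uv.
  have {uv} : upair (pair_map nu u) = upair v \/ (upair u = upair v /\ u != v).
    by case/orP: uv => [/eqP|/andP[/eqP]]; [left|right].
  case/setU1P: uF => [->|uF]; case/setU1P: vF => [->|vF].
  - by case=> [/eqP|[_]]; rewrite ?eqxx // (negbTE (selfc _ yK)).
  - case=> [/eqP E|[/eqP E _]]; exists v => //; rewrite inE yK /=.
      by rewrite E !orbT.
    by rewrite E.
  - case=> [/eqP E|[/eqP E _]]; exists u => //; rewrite inE yK /=.
      by rewrite [_ == upair (pair_map nu u)]eq_sym E !orbT.
    by rewrite eq_sym E.
  - have /forall_inP/(_ v vF)/andP[E1 /implyP E2] := Ffree u uF.
    case=> [E|[/eqP E]]; first by rewrite E eqxx in E1.
    by rewrite (E2 E).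
apply: (@leq_trans (\sum_(y in K) \sum_(x in F) (y \in conflicts nu K x))%N).
  rewrite -sum1_card; apply: leq_sum => y /cover[x xF yx].
  by rewrite (bigD1 x) //= yx.
rewrite exchange_big /= big_distrr /=; apply: leq_sum => x xF.
rewrite -big_mkcondr /= sum1_card.
apply: leq_trans (card_conflicts nuW KA (fintype.subsetP FK x xF)).
apply: subset_leq_card; apply/fintype.subsetP => y.
by rewrite unfold_in => /andP[].
Qed.

End Misalignment.

(** Reading the second graph through [pi^-1], a matching becomes a map from
    vertices to vertices whose correct value is the identity; extended by the
    identity it is still injective on [aligned_dom]. *)
Lemma kcore_misalignment (n k : nat) (G G1 G2 : sgraph n) (pi : {perm 'I_n})
    (M : {set 'I_n}) (mu : {ffun 'I_n -> 'I_n}) (i : 'I_n) :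
  G1 \subset G -> G2 \subset G -> kcore_matching k G1 (relabel pi G2) (M, mu) ->
  i \in M -> mu i != pi i ->
  exists nu : {ffun 'I_n -> 'I_n}, misalignment k nu G.
Proof.
move=> G1G G2G [mu_inj /= mu_deg] iM mui.
pose nu : {ffun 'I_n -> 'I_n} := [ffun j => if j \in M then (pi^-1)%g (mu j) else j].
have nuE j : j \in M -> nu j = (pi^-1)%g (mu j) by move=> jM; rewrite ffunE jM.
have WM j : j \in displaced nu -> j \in M.
  by rewrite inE ffunE; case: ifP; rewrite ?eqxx.
have nu_inj : {in M &, injective nu}.
  by move=> a b aM bM; rewrite !nuE // => /perm_inj; exact: mu_inj.
exists nu; apply/and3P; split.
- apply/finset.set0Pn; exists i; rewrite inE nuE //.
  by apply: contraNneq mui => E; rewrite -[X in pi X]E permKV.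
- apply/forall_inP => a aW; apply/forall_inP => b bW; apply/implyP => /eqP E.
  by apply/eqP; apply: nu_inj => //; exact: WM.
apply/forall_inP => a aW; have aM := WM a aW.
apply: leq_trans (mu_deg a aM) _; apply: subset_leq_card.
apply/fintype.subsetP => j; rewrite !inE /= => /andP[jM /andP[aj]].
rewrite adj_relabel -!nuE // => naj.
rewrite (adj_sub G1G aj) (adj_sub G2G naj) andbT andbT.
case: eqVneq => //= njj; apply/imsetP => -[b bW E].
have bM := WM b bW; move: bW; rewrite inE.
by rewrite (nu_inj b j) ?njj ?eqxx // -E njj.
Qed.

(** * Union bound for one displacement map *)

Lemma union_bound (R : numDomainType) (T I : finType) (P : pred T) (C : pred I)
    (Q : I -> pred T) (w : T -> R) :
  (forall t, 0 <= w t) -> (forall t, P t -> exists2 i, C i & Q i t) ->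
  \sum_(t | P t) w t <= \sum_(i | C i) \sum_(t | Q i t) w t.
Proof.
move=> w0 PQ; rewrite (eq_bigr (fun i => \sum_t if Q i t then w t else 0)); last first.
  by move=> i _; rewrite [LHS]big_mkcond.
rewrite exchange_big /= [leLHS]big_mkcond /=; apply: ler_sum => t _.
have nn i : 0 <= (if Q i t then w t else 0) by case: ifP.
case: ifP => [/PQ[i Ci Qi]|_]; last exact: sumr_ge0.
by rewrite (bigD1 i) //= Qi lerDl sumr_ge0.
Qed.

Lemma card_displaced_le (n : nat) (W : {set 'I_n}) :
  (#|[set nu : {ffun 'I_n -> 'I_n} | displaced nu == W]| <= n ^ #|W|)%N.
Proof.
pose P (i : 'I_n) : pred 'I_n := [pred j | (i \in W) || (j == i)].
apply: (@leq_trans #|family P|).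
  apply: subset_leq_card; apply/fintype.subsetP => nu; rewrite inE => /eqP E.
  by apply/familyP => i; rewrite unfold_in /= -E inE; case: eqVneq.
have -> : #|family P| = (\prod_(i in 'I_n) #|P i|)%N.
  by rewrite card_family foldrE big_map big_enum.
rewrite [leqLHS](bigID (mem W)) /= -[leqRHS]muln1 leq_mul //.
  rewrite -prod_nat_const; apply: leq_prod => i _.
  by rewrite -[leqRHS]card_ord max_card.
rewrite big1 // => i iW; rewrite -(card1 i); apply: eq_card => j.
by rewrite !inE (negbTE iW).
Qed.

Lemma sum_by_card (R : numDomainType) (n : nat) (h : nat -> R) :
  \sum_(W : {set 'I_n}) h #|W| = \sum_(d < n.+1) 'C(n, d)%:R * h d.
Proof.
have cn (W : {set 'I_n}) : (#|W| < n.+1)%N by rewrite ltnS -[leqRHS]card_ord max_card.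
rewrite (partition_big (fun W => Ordinal (cn W)) predT) //=.
apply: eq_bigr => d _.
rewrite (eq_bigr (fun=> h d)) => [|W /eqP <- //].
rewrite sumr_const [RHS]mulr_natl; congr (_ *+ _).
rewrite -[X in 'C(X, d)](card_ord n) -card_draws; apply: eq_card => W.
by rewrite [RHS]inE.
Qed.

Section UnionBound.
Context {R : realType} {n : nat}.
Variables (p : vpair n -> R) (qm : R).
Hypothesis p_le : forall e, 0 <= p e <= qm.
Hypothesis p_le1 : forall e, p e <= 1.
Hypothesis qm_ge0 : 0 <= qm.

Let mass (G : sgraph n) : R := \prod_e bern (p e) (e \in G).

Let mass_ge0 G : 0 <= mass G.
Proof.
apply: prodr_ge0 => e _; apply: bern_ge0.
by rewrite p_le1 andbT; case/andP: (p_le e).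
Qed.

Lemma prob_free_arcs_le (nu : {ffun 'I_n -> 'I_n}) (F : {set 'I_n * 'I_n}) :
  inj_displaced nu -> F \subset arcs nu -> free_arcs nu F ->
  \sum_(G : sgraph n | F \subset kept_arcs nu G) mass G <= (qm ^+ 2) ^+ #|F|.
Proof.
move=> nuW FA /forall_inP Ff.
have D := aligned_dom_inj nuW.
have FD x : x \in F -> [/\ x.1 != x.2 & nu x.1 != nu x.2].
  move=> xF; have [_ x1 x2 xx] := arcs_domP (fintype.subsetP FA x xF); split=> //.
  by apply: contra xx => /eqP/(D _ _ x1 x2)/eqP.
have F1 x y : x \in F -> y \in F -> upair (pair_map nu x) <> upair y.
  by move=> xF yF; move/forall_inP/(_ y yF)/andP: (Ff x xF) => [/eqP].
have F2 x y : x \in F -> y \in F -> upair x = upair y -> x = y.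
  move=> xF yF E; move/forall_inP/(_ y yF)/andP: (Ff x xF) => [_ /implyP].
  by rewrite E eqxx => /(_ isT)/eqP.
have F3 x y : x \in F -> y \in F -> upair (pair_map nu x) = upair (pair_map nu y) -> x = y.
  move=> xF yF /(upair_pair_map_eq nuW (fintype.subsetP FA _ xF) (fintype.subsetP FA _ yF)).
  exact: F2.
have cI : {in F &, injective (pair_map nu)}.
  by move=> x y xF yF E; apply: F3; rewrite ?E.
pose K := (F :|: pair_map nu @: F)%SET.
have <- : qm ^+ #|K| = (qm ^+ 2) ^+ #|F|.
  rewrite -exprM; congr (_ ^+ _).
  rewrite cardsU (card_in_imset cI) mul2n -addnn.
  rewrite (_ : (F :&: _)%SET = finset.set0) ?cards0 ?subn0 //.
  apply/setP => x; rewrite !inE; apply/negP => /andP[xF /imsetP[y yF E]].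
  by apply: (F1 y x) => //; rewrite E.
have KP x : x \in K -> x \in F \/ exists2 y, y \in F & x = pair_map nu y.
  by rewrite inE => /orP[|/imsetP]; [left|right].
apply: le_trans (_ : \sum_(G : sgraph n | [forall x in K, adj G x.1 x.2]) mass G <= _).
  rewrite [leLHS]big_mkcond [leRHS]big_mkcond /=; apply: ler_sum => G _.
  case: ifP => FG; last by case: ifP.
  case: ifPn => // /negP; case; apply/forall_inP => x /KP[xF|[y yF ->]].
    by move/fintype.subsetP/(_ x xF): FG; rewrite inE => /andP[_ /and3P[]].
  by move/fintype.subsetP/(_ y yF): FG; rewrite inE => /andP[_ /and3P[]].
apply: prob_all_adj_le => //.
  by move=> x /KP[/FD[]//|[y /FD[_ ? ->]]].
move=> x y /KP[xF|[x' xF ->]] /KP[yF|[y' yF ->]] E.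
- exact: F2.
- by case: (F1 _ _ yF xF).
- by case: (F1 _ _ xF yF).
- by rewrite (F3 _ _ xF yF E).
Qed.

(** A displaced set of size [d] has at most [d * n] arcs leaving it and at
    most [d ^ 2] inside it; the parameter [lam] tilts the sum over arc families
    towards the required total weight [4 * d]. *)
Lemma prob_misalignment_le (nu : {ffun 'I_n -> 'I_n}) (lam : R) (d : nat) :
  1 <= lam -> #|displaced nu| = d ->
  \sum_(G : sgraph n | misalignment 13 nu G) mass G <=
    lam ^- (4 * d) * expR (d%:R * n%:R * lam * qm ^+ 2
                           + d%:R ^+ 2 * lam ^+ 2 * qm ^+ 2).
Proof.
move=> lam1 dE; have lam0 : 0 < lam by apply: lt_le_trans lam1.
have [nuW|nuW] := boolP (inj_displaced nu); last first.
  rewrite big_pred0 ?mulr_ge0 ?expR_ge0 ?invr_ge0 ?exprn_ge0 ?(ltW lam0) //.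
  by move=> G; apply/negP => /and3P[_]; rewrite (negbTE nuW).
pose C (F : {set 'I_n * 'I_n}) := [&& F \subset arcs nu, free_arcs nu F &
   (4 * d <= \sum_(x in F) arc_weight nu x)%N].
apply: (@le_trans _ _ (\sum_(F | C F) \sum_(G | F \subset kept_arcs nu G) mass G)).
  apply: union_bound => // G mis.
  have [F /andP[FK Ff] Fw] := exists_free_arcs G nuW.
  exists F => //; apply/and3P; split=> //.
    by apply: fintype.subset_trans FK _; apply/fintype.subsetP => x; rewrite inE => /andP[].
  rewrite -(leq_pmul2l (isT : (0 < 3)%N)) mulnA; apply: leq_trans Fw.
  by rewrite -dE; exact: card_kept_arcs mis.
pose g x := lam ^+ arc_weight nu x * qm ^+ 2.
have g0 x : 0 <= g x by rewrite mulr_ge0 ?exprn_ge0 // ltW.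
apply: (@le_trans _ _ (\sum_(F : {set 'I_n * 'I_n} | F \subset arcs nu)
          lam ^- (4 * d) * \prod_(x in F) g x)).
  rewrite [leLHS]big_mkcond [leRHS]big_mkcond /=; apply: ler_sum => F _.
  have r0 : 0 <= lam ^- (4 * d) * \prod_(x in F) g x.
    by rewrite mulr_ge0 ?prodr_ge0 // invr_ge0 exprn_ge0 // ltW.
  case: ifP => [/and3P[FA Ff Fw]|_]; last by case: ifP.
  rewrite FA; apply: le_trans (prob_free_arcs_le nuW FA Ff) _.
  rewrite big_split /= prodr_const -expr_sum mulrA ler_peMl ?exprn_ge0 //.
  by rewrite mulrC ler_pdivlMr ?exprn_gt0 // mul1r ler_weXn2l.
rewrite -mulr_sumr sum_set_prod1D ler_pM2l ?invr_gt0 ?exprn_gt0 //.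
apply: le_trans (prod1D_le_expR _ g0) _; rewrite ler_expR.
pose W := displaced nu.
apply: (@le_trans _ _ (\sum_(x in finset.setX W [set: 'I_n]) lam * qm ^+ 2 +
                       \sum_(x in finset.setX W W) lam ^+ 2 * qm ^+ 2)).
  rewrite [leLHS]big_mkcond [X in _ <= X + _]big_mkcond [X in _ <= _ + X]big_mkcond.
  rewrite -big_split /=; apply: ler_sum => x _; rewrite ![_ \in finset.setX _ _]inE [_ \in finset.setTfor _]inE andbT.
  have l0 k : 0 <= lam ^+ k * qm ^+ 2 by rewrite mulr_ge0 ?exprn_ge0 // ltW.
  case: ifP => [/arcs_domP[-> _ _ _]|_] /=; rewrite /g /arc_weight -/W.
    by case: ifP => _; rewrite ?addr0 // lerDr (l0 1%N).
  by rewrite addr_ge0 //; case: ifP => // _; exact: (l0 1%N).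
rewrite !sumr_const !cardsX cardsT card_ord dE.
rewrite -[X in X + _]mulr_natl -[X in _ + X]mulr_natl !natrM.
by rewrite !mulrA.
Qed.

End UnionBound.

(** * Summation over all displacement maps *)

Lemma sum_geometric_le (R : realFieldType) (r : R) (n : nat) : 0 <= r <= 2^-1 ->
  \sum_(1 <= d < n.+1) r ^+ d <= 2 * r.
Proof.
move=> /andP[r0 r2].
suff : \sum_(1 <= d < n.+1) r ^+ d <= 2 * r - 2 * (r ^+ n * r).
  by move=> h; apply: le_trans h _; rewrite gerBl !mulr_ge0 ?exprn_ge0.
elim: n => [|n IH]; first by rewrite big_geq // expr0; lra.
rewrite big_nat_recr //= !exprSr.
have : 0 <= (r ^+ n * r) * (2^-1 - r).
  by rewrite !mulr_ge0 ?exprn_ge0 // subr_ge0.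
by move: IH; set a := r ^+ n * r; nra.
Qed.

Section Summation.
Context {R : realType} {n : nat}.
Variables (p : vpair n -> R) (qm x : R).
Hypothesis p_le : forall e, 0 <= p e <= qm.
Hypothesis p_le1 : forall e, p e <= 1.
Hypothesis qm_ge0 : 0 <= qm.
Hypothesis x_ge1 : 1 <= x.
Hypothesis x_n : x ^+ 10 = n%:R.
Hypothesis qm_le : qm <= x ^- 9.

(** With [lam = x ^ 8 / sqrt d] both exponents in [prob_misalignment_le] are
    at most [d], while [lam ^ 4 = x ^ 32 / d ^ 2] beats the number
    ['C(n, d) * n ^ d] of choices of [nu] for every [d <= n]. *)
Lemma misalignment_term_le (d : nat) : (0 < d)%N -> (d <= n)%N ->
  let lam := x ^+ 8 / Num.sqrt d%:R in
  1 <= lam /\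
  'C(n, d)%:R * (n%:R ^+ d * (lam ^- (4 * d) *
      expR (d%:R * n%:R * lam * qm ^+ 2 + d%:R ^+ 2 * lam ^+ 2 * qm ^+ 2)))
    <= (expR 3 / x ^+ 2) ^+ d.
Proof.
move=> d0 dn lam.
have x0 : 0 < x by apply: lt_le_trans x_ge1.
have n0 : (0 < n)%N by apply: leq_trans dn.
have d1R : 1 <= d%:R :> R by rewrite ler1n.
have dnR : d%:R <= x ^+ 10 by rewrite x_n ler_nat.
pose t := Num.sqrt d%:R : R.
have t2 : t ^+ 2 = d%:R by rewrite sqr_sqrtr.
have t1 : 1 <= t by rewrite -sqrtr1 ler_wsqrtr.
have t0 : 0 < t by apply: lt_le_trans t1.
have tx : t <= x ^+ 5.
  rewrite -(@ler_pXn2r _ 2) ?nnegrE ?exprn_ge0 ?(ltW t0) ?(ltW x0) //.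
  by rewrite t2 -exprM.
have lamE : lam * t = x ^+ 8 by rewrite divfK // gt_eqF.
have lam1 : 1 <= lam.
  rewrite /lam ler_pdivlMr // mul1r -/t; apply: le_trans tx _.
  by rewrite ler_weXn2l.
have lam0 : 0 < lam by apply: lt_le_trans lam1.
split=> //; clearbody lam t.
have q2 : qm ^+ 2 <= x ^- 18.
  rewrite (_ : x ^- 18 = (x ^- 9) ^+ 2); last by rewrite exprVn -exprM.
  by rewrite lerXn2r ?nnegrE ?invr_ge0 ?exprn_ge0 // ltW.
have x18 : x ^+ 18 * x ^- 18 = 1 by rewrite divff // gt_eqF ?exprn_gt0.
have lam2 : d%:R * lam ^+ 2 = x ^+ 16 by rewrite -t2 -exprMn mulrC lamE -exprM.
have lamx : lam <= x ^+ 8 by rewrite -lamE ler_peMr // ltW.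
have xp k : 0 < x ^+ k by rewrite exprn_gt0.
have E1 : d%:R * n%:R * lam * qm ^+ 2 <= d%:R.
  rewrite (_ : _ * _ = d%:R * (n%:R * (lam * qm ^+ 2))); last by ring.
  rewrite ler_piMr // -x_n.
  apply: (@le_trans _ _ (x ^+ 10 * (x ^+ 8 * x ^- 18))).
    by rewrite ler_pM2l //; apply: ler_pM => //; rewrite ?exprn_ge0 // ltW.
  by rewrite mulrA -exprD x18.
have E2 : d%:R ^+ 2 * lam ^+ 2 * qm ^+ 2 <= d%:R.
  rewrite (_ : _ * _ = d%:R * (d%:R * lam ^+ 2 * qm ^+ 2)); last by ring.
  rewrite ler_piMr // lam2.
  apply: (@le_trans _ _ (x ^+ 18 * x ^- 18)); last by rewrite x18.
  by apply: ler_pM => //; rewrite ?exprn_ge0 ?(ltW x0) // ler_weXn2l.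
have lam4 : lam ^+ 4 = x ^+ 32 / d%:R ^+ 2.
  have -> : x ^+ 32 = (x ^+ 16) ^+ 2 by rewrite -exprM.
  rewrite -lam2 exprMn mulrAC divff ?mul1r -?exprM //.
  by rewrite gt_eqF // exprn_gt0 // (lt_le_trans _ d1R).
apply: (@le_trans _ _ ('C(n, d)%:R * (n%:R ^+ d * ((d%:R ^+ 2 / x ^+ 32) ^+ d *
    expR 2 ^+ d)))).
  rewrite ler_wpM2l // ler_wpM2l ?exprn_ge0 // exprM lam4.
  rewrite -[d%:R ^+ 2 / x ^+ 32]invf_div exprVn.
  rewrite ler_wpM2l ?invr_ge0 //.
    by rewrite !(exprn_ge0, divr_ge0) // ltW.
  by rewrite -expRM_natl ler_expR; move: E1 E2; lra.
rewrite (_ : _ * _ = 'C(n, d)%:R * d%:R ^+ d *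
   (n%:R * d%:R / x ^+ 32 * expR 2) ^+ d); last first.
  rewrite (_ : d%:R ^+ 2 / x ^+ 32 = d%:R * (d%:R / x ^+ 32)) ?mulrA -?expr2 //.
  by rewrite !exprMn !mulrA; congr (_ * _); rewrite -!mulrA; congr (_ * _);
     rewrite mulrCA.
apply: le_trans (ler_wpM2r _ (bin_mul_exp_le R d n0)) _.
  by rewrite exprn_ge0 // !mulr_ge0 ?expR_ge0 ?invr_ge0 // ltW.
rewrite -exprMn lerXn2r ?nnegrE ?mulr_ge0 ?invr_ge0 ?expR_ge0 ?(ltW (xp _)) //.
rewrite (_ : 3 = 1 + 2 :> R) ?(expRD 1 2); last by ring.
rewrite -x_n ler_pdivlMr //.
rewrite [leLHS](_ : _ = expR 1 * expR 2 * (d%:R * (x ^+ 22 * x ^- 32))); last first.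
  by set y := x ^- 32; ring.
rewrite ler_piMr ?mulr_ge0 ?expR_ge0 // mulrA ler_pdivrMr // mul1r.
by rewrite (_ : x ^+ 32 = x ^+ 10 * x ^+ 22) ?ler_pM2r // -exprD.
Qed.

Lemma prob_misaligned_le : 2 * expR 3 <= x ^+ 2 ->
  \sum_(G : sgraph n | [exists nu, misalignment 13 nu G])
     \prod_e bern (p e) (e \in G) <= 2 * (expR 3 / x ^+ 2).
Proof.
move=> x_large.
have x0 : 0 < x by apply: lt_le_trans x_ge1.
have xx0 : 0 < x ^+ 2 by rewrite exprn_gt0.
pose lam d := x ^+ 8 / Num.sqrt d%:R : R.
pose g d : R := if d == 0%N then 0 else lam d ^- (4 * d) *
  expR (d%:R * n%:R * lam d * qm ^+ 2 + d%:R ^+ 2 * lam d ^+ 2 * qm ^+ 2).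
have lam0 d : 0 <= lam d by rewrite divr_ge0 ?exprn_ge0 ?sqrtr_ge0 // ltW.
have g0 d : 0 <= g d.
  by rewrite /g; case: eqP => // _; rewrite mulr_ge0 ?expR_ge0 ?invr_ge0 ?exprn_ge0.
have dn (W : {set 'I_n}) : (#|W| <= n)%N by rewrite -[leqRHS]card_ord max_card.
apply: (@le_trans _ _ (\sum_(nu | displaced nu != finset.set0)
   \sum_(G : sgraph n | misalignment 13 nu G) \prod_e bern (p e) (e \in G))).
  apply: union_bound => [G|G /fintype.existsP[nu mis]].
    apply: prodr_ge0 => e _; apply: bern_ge0.
    by rewrite p_le1 andbT; case/andP: (p_le e).
  by exists nu => //; case/and3P: mis.
apply: (@le_trans _ _ (\sum_(nu : {ffun 'I_n -> 'I_n}) g #|displaced nu|)).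
  rewrite [leLHS]big_mkcond /=; apply: ler_sum => nu _; case: ifPn => // nu0.
  have d0 : (0 < #|displaced nu|)%N by rewrite card_gt0.
  rewrite /g gtn_eqF //; apply: prob_misalignment_le => //.
  by case: (misalignment_term_le d0 (dn _)).
rewrite (partition_big (@displaced n) predT) //=.
apply: (@le_trans _ _ (\sum_(W : {set 'I_n}) n%:R ^+ #|W| * g #|W|)).
  apply: ler_sum => W _; rewrite (eq_bigr (fun=> g #|W|)) => [|nu /eqP -> //].
  rewrite sumr_const -[leLHS]mulr_natl ler_wpM2r // -natrX ler_nat.
  apply: leq_trans (card_displaced_le W); apply: eq_leq.
  by apply: eq_card => nu; rewrite inE.
rewrite (sum_by_card n (fun d => n%:R ^+ d * g d)).
rewrite big_ord_recl /= /g eqxx !mulr0 add0r.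
apply: (@le_trans _ _ (\sum_(1 <= d < n.+1) (expR 3 / x ^+ 2) ^+ d)); last first.
  apply: sum_geometric_le; rewrite divr_ge0 ?expR_ge0 ?(ltW xx0) //=.
  by rewrite ler_pdivrMr //; move: x_large; lra.
rewrite big_add1 big_mkord; apply: ler_sum => i _ /=.
rewrite /bump leq0n add1n.
by case: (@misalignment_term_le i.+1 isT (ltn_ord i)).
Qed.

End Summation.

(** * Peeling and edge cuts *)

Definition cut (n : nat) (S : {set 'I_n}) : {set vpair n} :=
  [set e : vpair n | ((val e).1 \in S) != ((val e).2 \in S)].

(** Orienting each edge of the cut from [S] to its complement. *)
Lemma sum_cut (R : nmodType) (n : nat) (S : {set 'I_n}) (F : 'I_n -> 'I_n -> R) :
  (forall i j, F i j = F j i) ->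
  \sum_(e in cut S) F (val e).1 (val e).2
    = \sum_(i in S) \sum_(j in ~: S) F i j.
Proof.
move=> Fsym; rewrite pair_big /=.
pose h (e : vpair n) : 'I_n * 'I_n :=
  if (val e).1 \in S then val e else ((val e).2, (val e).1).
pose h' (x : 'I_n * 'I_n) : option (vpair n) := insub (upair x).
rewrite (reindex_omap h h'); last first.
  move=> [i j] /= /andP[iS]; rewrite inE => jS.
  have ij : (i, j).1 != (i, j).2 by apply: contraNneq jS => /= <-.
  rewrite /h' insubT ?upair_lt //= => lt; congr Some.
  by rewrite /h SubK /upair /=; case: (i < j)%N; rewrite /= ?iS ?(negbTE jS).
apply: eq_big => [e|e]; last first.
  by rewrite /h inE => ecut; case: ifP => //= _; rewrite Fsym.
rewrite /h' !inE /h; case: ifP => /= eS.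
  rewrite upair_val valK eqxx andbT eS /=.
  by case: (_ \in S).
rewrite eS andbT /= -[(_, _)]/((val e).2, (val e).1).
have -> : upair ((val e).2, (val e).1) = val e.
  by rewrite upair_swap -surjective_pairing upair_val.
by rewrite valK eqxx andbT; case: (_ \in S).
Qed.

Lemma card_cut_le (n k : nat) (H : sgraph n) (S : {set 'I_n}) :
  {in S, forall i, #|[set j in ~: S | adj H i j]| <= k}%N ->
  (#|H :&: cut S| <= k * #|S|)%N.
Proof.
move=> deg; have -> : #|H :&: cut S| =
    (\sum_(e in cut S) (adj H (val e).1 (val e).2 : nat))%N.
  rewrite -sum1_card [RHS](eq_bigr (fun e => if e \in H then 1 else 0)%N).
    by rewrite -big_mkcondr /=; apply: eq_bigl => e; rewrite !inE andbC.
  by move=> e _; rewrite adj_val; case: (e \in H).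
have := @sum_cut nat n S (fun i j => nat_of_bool (adj H i j)).
move=> -> => [|i j]; last by rewrite adj_sym.
rewrite mulnC -sum_nat_const; apply: leq_sum => i iS.
apply: leq_trans (deg i iS); rewrite -sum1_card [leqRHS]big_mkcond [leqLHS]big_mkcond.
by apply: leq_sum => j _; rewrite !inE; case: (j \in S); case: (adj _ _ _).
Qed.

(** The vertices removed one after the other by the peeling algorithm: each
    has at most [k] neighbours that survive it, a fortiori at most [k] outside
    the removed set. *)
Lemma peeling (n k t : nat) (H : sgraph n) :
  (forall M : {set 'I_n},
     {in M, forall i, k < #|[set j in M | adj H i j]|}%N -> (#|M| + t <= n)%N) ->
  exists S : {set 'I_n}, #|S| = t /\
    {in S, forall i, #|[set j in ~: S | adj H i j]| <= k}%N.
Proof.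
move=> core.
suff peel u : (u <= t)%N -> exists S : {set 'I_n}, #|S| = u /\
    {in S, forall i, #|[set j in ~: S | adj H i j]| <= k}%N by exact: peel.
elim: u => [|u IH] ut.
  by exists finset.set0; rewrite cards0; split=> // i; rewrite inE.
have [S [Su Sdeg]] := IH (ltnW ut).
have SC : (#|~: S| = n - u)%N by rewrite cardsCs finset.setCK card_ord Su.
have : ~~ [forall i in ~: S, k < #|[set j in ~: S | adj H i j]|]%N.
  apply/negP => /forall_inP /core; rewrite SC => le.
  have := max_card (mem S); rewrite Su card_ord => un.
  by move: le; rewrite -[X in (_ <= X)%N](subnK un) leq_add2l leqNgt ut.
case/forall_inPn => v; rewrite inE => vS; rewrite -leqNgt => vdeg.
exists (v |: S)%SET; split; first by rewrite cardsU1 vS Su.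
move=> i; rewrite inE => iS.
apply: (@leq_trans #|[set j in ~: S | adj H i j]|).
  apply: subset_leq_card; apply/fintype.subsetP => j; rewrite !inE negb_or.
  by move=> /andP[/andP[_ ->] ->].
by case/orP: iS => [/set1P->|/Sdeg].
Qed.

(** * Expectations in the correlated model *)

Section Subsampling.
Context {R : realType} {n m : nat}.
Variables (V : 'I_m -> {set 'I_n}) (q : 'I_m -> 'I_m -> R) (s : R).
Hypothesis prob01 : forall i j, 0 <= edge_prob V q i j <= 1.
Hypothesis s01 : 0 <= s <= 1.

Definition triple_mass (G G1 G2 : sgraph n) : R :=
  sbm_mass V q G * subsample_mass s G G1 * subsample_mass s G G2.

Lemma sbm_mass_ge0 G : 0 <= sbm_mass V q G.
Proof. by apply: prodr_ge0 => e _; exact: bern_ge0. Qed.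

Lemma subsample_mass_ge0 (G H : sgraph n) : 0 <= subsample_mass s G H.
Proof.
by apply: prodr_ge0 => e _; apply: bern_ge0; case: ifP; rewrite ?lexx ?ler01.
Qed.

Lemma triple_mass_ge0 G G1 G2 : 0 <= triple_mass G G1 G2.
Proof. by rewrite !mulr_ge0 ?sbm_mass_ge0 ?subsample_mass_ge0. Qed.

Lemma sum_sbm_mass : \sum_G sbm_mass V q G = 1.
Proof.
rewrite /sbm_mass (sum_set_prod (fun e => bern (edge_prob V q (val e).1 (val e).2))).
by rewrite big1 // => e _; exact: sum_bern.
Qed.

Lemma sum_subsample_mass G : \sum_(H : sgraph n) subsample_mass s G H = 1.
Proof.
rewrite /subsample_mass (sum_set_prod (fun e => bern (if e \in G then s else 0))).
by rewrite big1 // => e _; exact: sum_bern.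
Qed.

Lemma subsample_mass_eq0 (G H : sgraph n) :
  ~~ (H \subset G) -> subsample_mass s G H = 0.
Proof.
case/fintype.subsetPn => e eH eG.
by rewrite /subsample_mass (bigD1 e) //= eH (negbTE eG) /= mul0r.
Qed.

Lemma sum_triple_mass G : \sum_G1 \sum_G2 triple_mass G G1 G2 = sbm_mass V q G.
Proof.
under eq_bigr => G1 _ do rewrite -mulr_sumr sum_subsample_mass mulr1.
by rewrite -mulr_sumr sum_subsample_mass mulr1.
Qed.

Lemma sum_perm_const (c : R) : \sum_(pi : {perm 'I_n}) c * (n`!%:R)^-1 = c.
Proof.
by rewrite sumr_const -[LHS]mulr_natr -mulrA card_Sn mulVf ?mulr1.
Qed.

Lemma csbm_prob_le1 E : csbm_prob V q s E <= 1.
Proof.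
apply: (@le_trans _ _ (\sum_G sbm_mass V q G)); last by rewrite sum_sbm_mass.
apply: ler_sum => G _; rewrite -sum_triple_mass.
apply: ler_sum => G1 _; apply: ler_sum => G2 _.
rewrite -[leRHS]sum_perm_const [leLHS]big_mkcond /=; apply: ler_sum => pi _.
by case: ifP => // _; rewrite mulr_ge0 ?triple_mass_ge0 ?invr_ge0.
Qed.

(** Both subsampled graphs are contained in the parent graph almost surely, so
    failures may be charged either to an event on the parent or to one on the
    intersection. *)
Lemma csbm_prob_ge (E : sgraph n -> sgraph n -> {perm 'I_n} -> bool)
    (A B : pred (sgraph n)) :
  (forall (G G1 G2 : sgraph n) pi, G1 \subset G -> G2 \subset G ->
     ~~ E G1 (relabel pi G2) pi -> A G || B (G1 :&: G2)) ->
  1 - (\sum_(G | A G) sbm_mass V q G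
       + \sum_G \sum_G1 \sum_(G2 | B (G1 :&: G2)) triple_mass G G1 G2)
    <= csbm_prob V q s E.
Proof.
move=> EAB; rewrite lerBlDr -{1}sum_sbm_mass [X in _ + (X + _)]big_mkcond /=.
rewrite -!big_split /=; apply: ler_sum => G _.
rewrite -[X in _ + (X + _)](_ : \sum_G1 \sum_G2
    (if A G then triple_mass G G1 G2 else 0) = _); last first.
  case: ifP => _; first exact: sum_triple_mass.
  by rewrite big1 // => G1 _; rewrite big1.
rewrite -[leLHS]sum_triple_mass -!big_split /=; apply: ler_sum => G1 _.
rewrite [X in _ + (_ + X)]big_mkcond /= -!big_split /=; apply: ler_sum => G2 _.
have T0 := triple_mass_ge0 G G1 G2.
have nn (c : bool) : 0 <= if c then triple_mass G G1 G2 else 0 by case: c.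
have [G1G|G1G] := boolP (G1 \subset G); last first.
  rewrite {1}/triple_mass (subsample_mass_eq0 G1G) mulr0 mul0r.
  rewrite !addr_ge0 // sumr_ge0 // => pi _.
  by rewrite mulr_ge0 // invr_ge0.
have [G2G|G2G] := boolP (G2 \subset G); last first.
  rewrite {1}/triple_mass (subsample_mass_eq0 G2G) mulr0.
  rewrite !addr_ge0 // sumr_ge0 // => pi _.
  by rewrite mulr_ge0 // invr_ge0.
rewrite -[X in _ <= _ + X]sum_perm_const -{1}[triple_mass G G1 G2]sum_perm_const.
rewrite [X in _ <= X + _]big_mkcond -big_split /=; apply: ler_sum => pi _.
rewrite /csbm_mass -/(triple_mass _ _ _).
have c0 : 0 <= (n`!%:R)^-1 :> R by rewrite invr_ge0.
case: ifPn => [_|/(EAB _ _ _ _ G1G G2G) AB].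
  by rewrite lerDl mulr_ge0 // addr_ge0.
rewrite add0r ler_wpM2r //.
by case/orP: AB => -> /=; rewrite ?lerDl ?lerDr.
Qed.

(** Each pair belongs to the intersection independently, with probability
    [p s ^ 2]; the test function halves for each edge crossing the cut. *)
Lemma sum_triple_mass_half (K : {set vpair n}) :
  \sum_G \sum_G1 \sum_G2 triple_mass G G1 G2 * 2^-1 ^+ #|(G1 :&: G2) :&: K|
  = \prod_(e in K) (1 - edge_prob V q (val e).1 (val e).2 * s ^+ 2 / 2).
Proof.
pose p (e : vpair n) := edge_prob V q (val e).1 (val e).2.
pose f e (b b1 b2 : bool) : R :=
  bern (p e) b * bern (if b then s else 0) b1 * bern (if b then s else 0) b2 *
  (if [&& e \in K, b1 & b2] then 2^-1 else 1).
transitivity (\sum_(G : sgraph n) \sum_(G1 : sgraph n) \sum_(G2 : sgraph n)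
    \prod_e f e (e \in G) (e \in G1) (e \in G2)).
  apply: eq_bigr => G _; apply: eq_bigr => G1 _; apply: eq_bigr => G2 _.
  rewrite /f !big_split /=; congr (_ * _).
  rewrite -prodr_const [LHS]big_mkcond /=; apply: eq_bigr => e _.
  by rewrite !inE andbC.
transitivity (\sum_(G : sgraph n) \sum_(G1 : sgraph n)
    \prod_e (f e (e \in G) (e \in G1) true + f e (e \in G) (e \in G1) false)).
  apply: eq_bigr => G _; apply: eq_bigr => G1 _.
  exact: (sum_set_prod (fun e => f e (e \in G) (e \in G1))).
transitivity (\sum_(G : sgraph n)
    \prod_e (f e (e \in G) true true + f e (e \in G) true false +
             (f e (e \in G) false true + f e (e \in G) false false))).
  apply: eq_bigr => G _.
  exact: (sum_set_prod (fun e b1 => f e (e \in G) b1 true + f e (e \in G) b1 false)).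
rewrite (sum_set_prod (fun e b => f e b true true + f e b true false +
  (f e b false true + f e b false false))).
rewrite [RHS]big_mkcond /=; apply: eq_bigr => e _.
rewrite /f /=; case: (e \in K) => /=; rewrite /p; set y := edge_prob _ _ _ _.
  by field.
by ring.
Qed.

End Subsampling.

(** * Community degrees and sparse cuts *)

Section FiniteExtremaTheory.
Context {R : realType} {I : finType}.
Implicit Types f : I -> R.

Let abs_le_sum f i : `|f i| <= \sum_j `|f j|.
Proof. by rewrite (bigD1 i) //= lerDl sumr_ge0. Qed.

Lemma fmin_le f i : fmin f <= f i.
Proof.
apply: ge_inf; last by exists i.
exists (- \sum_j `|f j|) => _ [j _ <-].
by rewrite lerNl; apply: le_trans (abs_le_sum f j); rewrite -normrN ler_norm.
Qed.

Lemma le_fmax f i : f i <= fmax f.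
Proof.
apply: ub_le_sup; last by exists i.
by exists (\sum_j `|f j|) => _ [j _ <-]; apply: le_trans (abs_le_sum f j); exact: ler_norm.
Qed.

Lemma le_fmin (i0 : I) f (c : R) : (forall i, c <= f i) -> c <= fmin f.
Proof. by move=> cf; apply: lb_le_inf => [|_ [j _ <-]//]; exists (f i0), i0. Qed.

Lemma fmax_le (i0 : I) f (c : R) : (forall i, f i <= c) -> fmax f <= c.
Proof. by move=> fc; apply: ge_sup => [|_ [j _ <-]//]; exists (f i0), i0. Qed.

End FiniteExtremaTheory.

Section Communities.
Context {R : realType} {n m : nat}.
Variables (V : 'I_m -> {set 'I_n}) (q : 'I_m -> 'I_m -> R) (s : R).
Hypothesis Vpart : community_partition V.
Hypothesis q_sym : forall a b, q a b = q b a.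
Hypothesis q01 : forall a b, 0 <= q a b <= 1.
Hypothesis s01 : 0 <= s <= 1.

Lemma community_exists i : exists a, i \in V a.
Proof.
case: Vpart => _ /and3P[/eqP cov _ _].
have : i \in [set: 'I_n]%SET by rewrite inE.
by rewrite -cov => /bigcupP[_ /imsetP[a _ ->] ia]; exists a.
Qed.

Lemma community_unique i a b : i \in V a -> (i \in V b) = (b == a).
Proof.
case: Vpart => Vinj /and3P[_ /finset.trivIsetP tri _] ia.
apply/idP/eqP => [ib|-> //]; apply/eqP; apply: contraT => ba.
have /pred0P/(_ i) : [disjoint V b & V a].
  by apply: tri; rewrite ?imset_f // (inj_eq Vinj).
by rewrite /= ia ib.
Qed.

Lemma sum_community_card : (\sum_b #|V b| = n)%N.
Proof.
case: Vpart => Vinj /card_partition; rewrite cardsT card_ord => nE.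
by rewrite [RHS]nE big_imset //= => a b _ _; exact: Vinj.
Qed.

Lemma edge_probE i j a b : i \in V a -> j \in V b ->
  edge_prob V q i j = if i == j then 0 else q a b.
Proof.
move=> ia jb; rewrite /edge_prob; case: ifP => // _.
rewrite (eq_bigl _ _ (fun c => community_unique c ia)) big_pred1_eq.
by rewrite (eq_bigl _ _ (fun c => community_unique c jb)) big_pred1_eq.
Qed.

Lemma edge_prob_sym i j : edge_prob V q i j = edge_prob V q j i.
Proof.
have [a ia] := community_exists i; have [b jb] := community_exists j.
by rewrite (edge_probE ia jb) (edge_probE jb ia) eq_sym q_sym.
Qed.

Lemma edge_prob_range i j : 0 <= edge_prob V q i j <= 1.
Proof.
have [a ia] := community_exists i; have [b jb] := community_exists j.
by rewrite (edge_probE ia jb); case: ifP; rewrite ?lexx ?ler01.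
Qed.

Lemma le_qmax a b : q a b <= qmax q.
Proof. exact: (le_fmax (fun ab => q ab.1 ab.2) (a, b)). Qed.

Lemma qmin_le a b : qmin q <= q a b.
Proof. exact: (fmin_le (fun ab => q ab.1 ab.2) (a, b)). Qed.

Lemma qmax_ge0 : (0 < n)%N -> 0 <= qmax q.
Proof.
move=> n0; have [a _] := community_exists (Ordinal n0).
by apply: le_trans (le_qmax a a); case/andP: (q01 a a).
Qed.

Lemma qmax_le1 : (0 < n)%N -> qmax q <= 1.
Proof.
move=> n0; have [a _] := community_exists (Ordinal n0).
by apply: (@fmax_le _ _ (a, a)) => ab; case/andP: (q01 ab.1 ab.2).
Qed.

Lemma edge_prob_le i j : edge_prob V q i j <= qmax q.
Proof.
have [a ia] := community_exists i; have [b jb] := community_exists j.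
rewrite (edge_probE ia jb); case: ifP => _; last exact: le_qmax.
by apply: le_trans (le_qmax a b); case/andP: (q01 a b).
Qed.

(** The community sum at [i] differs from the expected degree of [i] only by the
    term of [i] itself. *)
Lemma min_vertex_degree_ge : (0 < n)%N ->
  min_community_degree V q s - qmax q * s ^+ 2 <= min_vertex_degree V q s.
Proof.
move=> n0; apply: (le_fmin (Ordinal n0)) => i.
have [a ia] := community_exists i.
apply: (@le_trans _ _ (\sum_(b < m) #|V b|%:R * q a b * s ^+ 2 - qmax q * s ^+ 2)).
  by rewrite lerD2r; exact: (fmin_le _ a).
rewrite -!mulr_suml -mulrBl ler_wpM2r ?exprn_ge0 //; first by case/andP: s01.
pose F j := \sum_(b | j \in V b) q a b.
have -> : \sum_b #|V b|%:R * q a b = \sum_j F j.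
  rewrite /F (exchange_big_dep predT) //=; apply: eq_bigr => b _.
  by rewrite sumr_const mulr_natl.
rewrite lerBlDr (bigD1 i) //= [X in _ <= X + _](bigD1 i) //=.
rewrite (edge_probE ia ia) eqxx add0r addrC lerD //.
  apply: ler_sum => j ji; rewrite /edge_prob eq_sym (negbTE ji).
  by rewrite (eq_bigl _ _ (fun c => community_unique c ia)) big_pred1_eq.
by rewrite /F (eq_bigl _ _ (fun c => community_unique c ia)) big_pred1_eq le_qmax.
Qed.

(** Every community sum is at least [n * qmin * s ^ 2], so the bound on
    [qmax / qmin] turns into one on the largest possible degree. *)
Lemma qmax_degree_le : (0 < n)%N -> 0 < qmin q ->
  qmax q / qmin q <= min_community_degree V q s ->
  n%:R * qmax q * s ^+ 2 <= min_community_degree V q s ^+ 2.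
Proof.
move=> n0 qm0 rho; have [a0 _] := community_exists (Ordinal n0).
have s2 : 0 <= s ^+ 2 by rewrite exprn_ge0 //; case/andP: s01.
have base : n%:R * qmin q * s ^+ 2 <= min_community_degree V q s.
  apply: (le_fmin a0) => a; rewrite -mulr_suml ler_wpM2r //.
  rewrite -{1}sum_community_card natr_sum mulr_suml; apply: ler_sum => b _.
  by rewrite ler_wpM2l // qmin_le.
have -> : n%:R * qmax q * s ^+ 2 = (qmax q / qmin q) * (n%:R * qmin q * s ^+ 2).
  by field; rewrite gt_eqF.
rewrite [leRHS]expr2; apply: ler_pM => //; first by rewrite divr_ge0 ?qmax_ge0 // ltW.
by rewrite mulr_ge0 // mulr_ge0 // ltW.
Qed.

Definition sparse_cut (k t : nat) (H : sgraph n) : bool :=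
  [exists S : {set 'I_n}, (#|S| == t) && (#|H :&: cut S| <= k * t)%N].

(** Markov's inequality for [2 ^- #|H :&: cut S|], whose expectation is at most
    [exp (- mu / 2)] with [mu] the mean size of the cut, and a union bound over
    [S]. *)
Lemma prob_sparse_cut_le (k t : nat) (D : R) :
  (forall i, D <= \sum_j edge_prob V q i j * s ^+ 2) ->
  \sum_G \sum_G1 \sum_(G2 | sparse_cut k t (G1 :&: G2)) triple_mass V q s G G1 G2
    <= 'C(n, t)%:R *
       (2 ^+ (k * t) * expR (- (t%:R * (D - t%:R * (qmax q * s ^+ 2)) / 2))).
Proof.
move=> Ddeg; have s2 : 0 <= s ^+ 2 by rewrite exprn_ge0 //; case/andP: s01.
have s21 : s ^+ 2 <= 1 by rewrite exprn_ile1; case/andP: s01.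
have T0 := triple_mass_ge0 edge_prob_range s01.
apply: (@le_trans _ _ (\sum_(G : sgraph n) \sum_(G1 : sgraph n) \sum_(G2 : sgraph n)
  \sum_(S : {set 'I_n} | #|S| == t) 2 ^+ (k * t) *
     (triple_mass V q s G G1 G2 * 2^-1 ^+ #|(G1 :&: G2) :&: cut S|))).
  apply: ler_sum => G _; apply: ler_sum => G1 _.
  rewrite [leLHS]big_mkcond /=; apply: ler_sum => G2 _.
  have nn S : 0 <= 2 ^+ (k * t) *
     (triple_mass V q s G G1 G2 * 2^-1 ^+ #|(G1 :&: G2) :&: cut S|).
    by rewrite mulr_ge0 ?exprn_ge0 // mulr_ge0 ?T0 // exprn_ge0 // invr_ge0.
  case: ifP => [/fintype.existsP[S /andP[St Sle]]|_]; last exact: sumr_ge0.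
  rewrite (bigD1 S) //= -[leLHS]addr0 lerD ?sumr_ge0 //.
  rewrite mulrCA ler_peMr //.
  by rewrite exprVn ler_pdivlMr ?exprn_gt0 // mul1r ler_weXn2l // ler1n.
pose X (S : {set 'I_n}) G G1 G2 := 2 ^+ (k * t) *
     (triple_mass V q s G G1 G2 * 2^-1 ^+ #|(G1 :&: G2) :&: cut S|).
have -> : \sum_G \sum_G1 \sum_G2 \sum_(S : {set 'I_n} | #|S| == t) X S G G1 G2 =
  \sum_(S : {set 'I_n} | #|S| == t) \sum_G \sum_G1 \sum_G2 X S G G1 G2.
  rewrite [RHS]exchange_big /=; apply: eq_bigr => G _.
  rewrite [RHS]exchange_big /=; apply: eq_bigr => G1 _.
  by rewrite [RHS]exchange_big.
have -> : 'C(n, t) = #|[set S : {set 'I_n} | #|S| == t]|.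
  by rewrite card_draws card_ord.
rewrite mulr_natl -sumr_const [leRHS](eq_bigl (fun S : {set 'I_n} => #|S| == t)).
  2: by move=> S; rewrite inE.
apply: ler_sum => S /eqP St.
have -> : \sum_G \sum_G1 \sum_G2 X S G G1 G2 = 2 ^+ (k * t) *
    \prod_(e in cut S) (1 - edge_prob V q (val e).1 (val e).2 * s ^+ 2 / 2).
  rewrite -sum_triple_mass_half mulr_sumr; apply: eq_bigr => G _.
  rewrite mulr_sumr; apply: eq_bigr => G1 _.
  by rewrite mulr_sumr.
rewrite ler_wpM2l ?exprn_ge0 //; apply: le_trans (prod1B_le_expR _ _) _.
  move=> e; have /andP[p0 p1] := edge_prob_range (val e).1 (val e).2.
  have : edge_prob V q (val e).1 (val e).2 * s ^+ 2 <= 1 * 1 by apply: ler_pM.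
  by lra.
rewrite ler_expR lerN2 -mulr_suml ler_pM2r ?invr_gt0 //.
rewrite (sum_cut S (F := fun i j => edge_prob V q i j * s ^+ 2)); last first.
  by move=> i j; rewrite edge_prob_sym.
rewrite -{1}St mulr_natl -sumr_const; apply: ler_sum => i iS.
rewrite lerBlDr; apply: le_trans (Ddeg i) _.
rewrite (bigID (mem S)) /= addrC lerD //.
  by rewrite [leRHS](eq_bigl (fun j => j \notin S)) // => j; rewrite inE.
rewrite -{1}St [leRHS]mulr_natl -sumr_const; apply: ler_sum => j _.
by rewrite ler_wpM2r // edge_prob_le.
Qed.

End Communities.

(** * Bounds at a fixed number of vertices *)

Lemma sqr_le_expR (R : realType) (D : R) : 153 <= D ->
  (D + 1) ^+ 2 <= 16 * expR (D / 7).
Proof.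
move=> D153; have := expR_ge1Dx (D / 28).
have -> : expR (D / 7) = (expR (D / 28) ^+ 2) ^+ 2.
  by rewrite -exprM -expRM_natl; congr expR; field.
move=> h; have h2 : (1 + D / 28) ^+ 2 <= expR (D / 28) ^+ 2.
  by rewrite lerXn2r // ?nnegrE ?expR_ge0 //; lra.
have h3 : D + 1 <= 4 * expR (D / 28) ^+ 2.
  apply: (@le_trans _ _ (4 * (1 + D / 28) ^+ 2)); last by rewrite ler_pM2l.
  rewrite -subr_ge0 (_ : _ - _ = 3 + D * (D - 140) / 196); last by field.
  by rewrite addr_ge0 // divr_ge0 // mulr_ge0 //; lra.
have -> : 16 * (expR (D / 28) ^+ 2) ^+ 2 = (4 * expR (D / 28) ^+ 2) ^+ 2 by ring.
by rewrite lerXn2r ?nnegrE // ?mulr_ge0 ?exprn_ge0 ?expR_ge0 //; lra.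
Qed.

(** The entropy [1 + D / 7] of choosing a set of relative size
    [3 * expR (- D / 7)] is dominated by the large-deviation exponent
    [(D - X) / 2], with room for the factor [2 ^ 12]. *)
Lemma entropy_vs_deviation (R : realType) (D X : R) : 153 <= D -> X <= 50 ->
  expR 1 * expR (D / 7) / 3 * 2 ^+ 12 * expR (- (D - X) / 2) <= expR (- 1).
Proof.
move=> D153 X50.
have e1 : 2 <= expR 1 :> R by have := @expR_ge1Dx R 1; lra.
have e11 : 2 ^+ 11 <= expR 11 :> R.
  rewrite -[X in expR X]mulr1 expRM_natl lerXn2r ?nnegrE ?expR_ge0 //.
have -> : expR 1 * expR (D / 7) / 3 * 2 ^+ 12 * expR (- (D - X) / 2) =
    expR (1 + D / 7 - (D - X) / 2) * (2 ^+ 12 / 3).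
  by rewrite mulNr !expRD; field.
apply: (@le_trans _ _ (expR (- 12) * expR 11)).
  apply: ler_pM; rewrite ?expR_ge0 ?divr_ge0 ?exprn_ge0 //.
    by rewrite ler_expR; lra.
  by apply: le_trans e11; lra.
by rewrite -expRD ler_expR; lra.
Qed.

Section FiniteBound.
Context {R : realType} {n m : nat}.
Variables (V : 'I_m -> {set 'I_n}) (q : 'I_m -> 'I_m -> R) (s x : R).
Hypothesis Vpart : community_partition V.
Hypothesis q_sym : forall a b, q a b = q b a.
Hypothesis q01 : forall a b, 0 <= q a b <= 1.
Hypothesis s01 : 0 <= s <= 1.
Hypothesis n_gt0 : (0 < n)%N.
Hypothesis x_ge1 : 1 <= x.
Hypothesis x_n : x ^+ 10 = n%:R.
Hypothesis qmax_x : qmax q <= x ^- 9.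
Hypothesis qmin_gt0 : 0 < qmin q.
Hypothesis ratio_le : qmax q / qmin q <= min_community_degree V q s.
Hypothesis degree_ge : 154 <= min_community_degree V q s.

Let D := min_vertex_degree V q s.
(* [t] is the least integer above [u], so that a core of size below [n - u] has
   size at most [n - t]. *)
Let u : R := 3 * expR (- D / 7) * n%:R + x ^+ 9.
Let t := (Num.truncn u).+1.

Lemma prob_sparse_cut_small :
  \sum_G \sum_G1 \sum_(G2 | sparse_cut 12 t (G1 :&: G2)) triple_mass V q s G G1 G2
    <= x ^- 2.
Proof.
have x0 : 0 < x by apply: lt_le_trans x_ge1.
have nR : 0 < n%:R :> R by rewrite ltr0n.
have s2 : 0 <= s ^+ 2 by rewrite exprn_ge0 //; case/andP: s01.
have s21 : s ^+ 2 <= 1 by rewrite exprn_ile1; case/andP: s01.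
have q0 : 0 <= qmax q by exact: qmax_ge0 Vpart q01 n_gt0.
have q1 : qmax q <= 1 by exact: qmax_le1 Vpart q01 n_gt0.
have qs1 : qmax q * s ^+ 2 <= 1 by rewrite mulr_ile1.
have DD := min_vertex_degree_ge q Vpart s01 n_gt0; rewrite -/D in DD.
have D153 : 153 <= D by move: DD degree_ge qs1; lra.
have u0 : 0 <= u by rewrite addr_ge0 ?mulr_ge0 ?expR_ge0 ?exprn_ge0 // ltW.
have ut : u < t%:R by exact: truncnS_gt.
have tu : t%:R <= u + 1.
  rewrite -natr1 lerD2r; by case/andP: (truncn_itv u0).
have nq := qmax_degree_le Vpart q01 s01 n_gt0 qmin_gt0 ratio_le.
have e0 : 0 < expR (- D / 7) by exact: expR_gt0.
(* Vertices of [S] spend at most 50 of their mean degree inside [S]. *)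
have X50 : t%:R * (qmax q * s ^+ 2) <= 50.
  have x9 : x ^+ 9 * qmax q <= 1 by rewrite mulrC -ler_pdivlMr ?exprn_gt0 // div1r.
  apply: (@le_trans _ _ ((u + 1) * (qmax q * s ^+ 2))).
    by rewrite ler_wpM2r // mulr_ge0.
  rewrite /u !mulrDl mul1r.
  have A1 : x ^+ 9 * (qmax q * s ^+ 2) <= 1.
    by rewrite mulrA mulr_ile1 // mulr_ge0 // exprn_ge0 // ltW.
  have A2 : 3 * expR (- D / 7) * n%:R * (qmax q * s ^+ 2) <= 48.
    apply: (@le_trans _ _ (3 * expR (- D / 7) * (D + 1) ^+ 2)).
      rewrite -[leLHS]mulrA ler_pM2l ?mulr_gt0 // mulrA.
      apply: le_trans nq _; rewrite lerXn2r ?nnegrE //; move: degree_ge DD qs1; lra.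
    apply: (@le_trans _ _ (3 * expR (- D / 7) * (16 * expR (D / 7)))).
      by rewrite ler_pM2l ?mulr_gt0 // sqr_le_expR.
    rewrite (_ : _ * _ = 48 * (expR (- D / 7) * expR (D / 7))); last by ring.
    by rewrite -expRD mulNr addNr expR0 mulr1.
  by move: A1 A2 qs1; lra.
have deg i : D <= \sum_j edge_prob V q i j * s ^+ 2 by exact: fmin_le.
apply: le_trans (prob_sparse_cut_le Vpart q_sym q01 s01 12 t deg) _.
have t0 : 0 < t%:R :> R by rewrite ltr0n.
(* [t >= 3 * e^(- D / 7) * n] in the bound [(e * n / t) ^ t]. *)
have chooseT : 'C(n, t)%:R <= (expR 1 * expR (D / 7) / 3) ^+ t :> R.
  have := bin_mul_exp_le R t n_gt0.
  have y0 : 0 < 3 * expR (- D / 7) * n%:R by rewrite !mulr_gt0.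
  have yt : (3 * expR (- D / 7) * n%:R) ^+ t <= t%:R ^+ t.
    rewrite lerXn2r ?nnegrE ?(ltW y0) ?(ltW t0) //; apply: le_trans (ltW ut).
    by rewrite lerDl exprn_ge0 // ltW.
  move=> /(le_trans (ler_wpM2l (ler0n _ _) yt)).
  rewrite -ler_pdivlMr ?exprn_gt0 // -expr_div_n => /le_trans; apply.
  rewrite le_eqVlt; apply/orP; left; apply/eqP; congr (_ ^+ _).
  rewrite mulNr expRN; field.
  by rewrite !gt_eqF // expR_gt0.
apply: (@le_trans _ _ (expR (- 1) ^+ t)).
  rewrite (_ : expR (- (_ / 2)) =
      expR (- (D - t%:R * (qmax q * s ^+ 2)) / 2) ^+ t); last first.
    by rewrite -expRM_natl; congr expR; ring.
  rewrite exprM mulrA.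
  apply: le_trans (_ : (expR 1 * expR (D / 7) / 3 * 2 ^+ 12 *
     expR (- (D - t%:R * (qmax q * s ^+ 2)) / 2)) ^+ t <= _).
    rewrite !exprMn ler_wpM2r ?exprn_ge0 ?expR_ge0 //.
    by rewrite ler_wpM2r ?exprn_ge0 // -!exprMn.
  rewrite lerXn2r ?nnegrE ?mulr_ge0 ?exprn_ge0 ?expR_ge0 ?invr_ge0 //.
  exact: entropy_vs_deviation.
rewrite -expRM_natl mulrN1 expRN lef_pV2 ?posrE ?expR_gt0 ?exprn_gt0 //.
apply: le_trans (expR_ge1Dx _); apply: (@le_trans _ _ (x ^+ 9)).
  by rewrite ler_weXn2l.
apply: (@le_trans _ _ u); first by rewrite lerDr !mulr_ge0 // ltW.
by rewrite (le_trans (ltW ut)) // lerDr.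
Qed.

(** As a core matching, the estimator has no wrong pair unless the parent graph
    carries a misalignment; being at least as large as every core matching that
    follows [pi], it is large unless the intersection graph has a sparse cut. *)
Lemma csbm_estimator_ge (est : sgraph n -> sgraph n -> prematching n) :
  kcore_estimator 13 est -> 2 * expR 3 <= x ^+ 2 ->
  1 - (2 * expR 3 + 1) / x ^+ 2 <=
  csbm_prob V q s (fun G1 G2 pi =>
    ((1 - 3 * expR (- D / 7)) * n%:R - x ^+ 9 <= #|(est G1 G2).1|%:R)
    && (graph_on (est G1 G2).2 (est G1 G2).1 == graph_on pi (est G1 G2).1)).
Proof.
move=> est_core x_large; set E := (fun G1 G2 pi => _).
have x0 : 0 < x by apply: lt_le_trans x_ge1.
have prob01 := edge_prob_range Vpart q01.
pose A (G : sgraph n) := [exists nu, misalignment 13 nu G].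
apply: le_trans (csbm_prob_ge (A := A) (B := @sparse_cut n 12 t) prob01 s01 _).
  rewrite lerD2l lerN2 mulrDl div1r -mulrA; apply: lerD; last exact: prob_sparse_cut_small.
  apply: (prob_misaligned_le (qm := qmax q)) => //.
  - move=> e; case/andP: (prob01 (val e).1 (val e).2) => -> _ /=.
    exact: edge_prob_le.
  - by move=> e; case/andP: (prob01 (val e).1 (val e).2).
  - exact: qmax_ge0 Vpart q01 n_gt0.
move=> G G1 G2 pi G1G G2G; rewrite /E.
have [core maxi] := est_core G1 (relabel pi G2).
case: (est G1 (relabel pi G2)) core maxi => M mu /= core maxi.
rewrite negb_and => /orP[small|wrong]; apply/orP; [right|left]; last first.
  have [i iM mui] : exists2 i, i \in M & mu i != pi i.
    apply/exists_inP; apply: contraT => /exists_inPn same.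
    case/negP: wrong; apply/eqP; apply: eq_in_imset => i iM.
    by have := same i iM; rewrite negbK => /eqP ->.
  by apply/fintype.existsP; apply: (kcore_misalignment G1G G2G core iM mui).
have Mt : (#|M| + t <= n)%N.
  have Mn : (#|M| <= n)%N by rewrite -[leqRHS]card_ord max_card.
  rewrite -[leqRHS](subnKC Mn) leq_add2l /t truncn_lt_nat; last first.
    by rewrite addr_ge0 ?mulr_ge0 ?expR_ge0 ?exprn_ge0 // ltW.
  by move: small; rewrite -ltNge natrB // /u; lra.
have [S [St Sdeg]] : exists S : {set 'I_n}, #|S| = t /\
    {in S, forall i, #|[set j in ~: S | adj (G1 :&: G2) i j]| <= 12}%N.
  apply: peeling => M' core'; apply: leq_trans Mt; rewrite leq_add2r.
  pose mu' : {ffun 'I_n -> 'I_n} := [ffun i => pi i].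
  apply: (maxi (M', mu')); split.
    by move=> i j _ _ /=; rewrite !ffunE; exact: perm_inj.
  move=> i iM' /=; apply: leq_trans (core' i iM') _; apply: subset_leq_card.
  apply/fintype.subsetP => j; rewrite !inE /= adj_setI adj_relabel !ffunE.
  by rewrite !permK.
apply/fintype.existsP; exists S; rewrite St eqxx /=.
by rewrite -[X in (_ * X)%N]St; exact: card_cut_le.
Qed.

End FiniteBound.

(** * The limit *)

Lemma cvg_inv_root (R : realType) :
  ((fun n : nat => (n%:R `^ (10^-1) : R)^-1) @ \oo --> (0 : R))%classic.
Proof.
apply/cvgr0Pnorm_le => e e0; near=> n.
have n0 : 0 <= n%:R `^ (10^-1) :> R by exact: powR_ge0.
have ne : e^-1 <= n%:R `^ (10^-1) :> R.
  rewrite -(@ler_pXn2r _ 10) ?nnegrE ?invr_ge0 ?(ltW e0) //.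
  rewrite -[leRHS]powR_mulrn // -powRrM mulVf // powRr1 //.
  by near: n; exact: nbhs_infty_ger.
rewrite ger0_norm ?invr_ge0 // -[leRHS]invrK lef_pV2 ?posrE ?invr_gt0 //.
by apply: lt_le_trans ne; rewrite invr_gt0.
Unshelve. all: by end_near. Qed.

Local Open Scope classical_set_scope.

Theorem corollary4 (R : realType)
  (m : nat -> nat)
  (V : forall n : nat, 'I_(m n) -> {set 'I_n})
  (q : forall n : nat, 'I_(m n) -> 'I_(m n) -> R)
  (s : nat -> R)
  (est : forall n : nat, sgraph n -> sgraph n -> prematching n)
  (eps : R)
  (V_partition : forall n : nat, community_partition (V n))
  (q_sym : forall (n : nat) (a b : 'I_(m n)), q n a b = q n b a)
  (q_range : forall (n : nat) (a b : 'I_(m n)), 0 <= q n a b <= 1)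
  (s_range : forall n : nat, 0 <= s n <= 1)
  (qmax_asymp : exists eta : nat -> R,
      eta @ \oo --> (0 : R) /\
      \forall n \near \oo, qmax (q n) = n%:R `^ (-1 + eta n))
  (eps_gt0 : 0 < eps)
  (degree_cond : \forall n \near \oo,
      0 < qmin (q n) /\
      Num.max (qmax (q n) / qmin (q n)) 154 + eps
        <= min_community_degree (V n) (q n) (s n))
  (est_kcore : forall n : nat, kcore_estimator 13 (est n)) :
  exists a : nat -> R,
    (fun n => a n / n%:R) @ \oo --> (0 : R) /\
    (fun n => csbm_prob (V n) (q n) (s n) (fun G1 G2 pi =>
       ((1 - 3 * expR (- min_vertex_degree (V n) (q n) (s n) / 7)) * n%:R - a n
          <= #|(est n G1 G2).1|%:R)
       && (graph_on (est n G1 G2).2 (est n G1 G2).1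
             == graph_on pi (est n G1 G2).1)))
      @ \oo --> (1 : R).
Proof.
have [eta [eta0 qmaxE]] := qmax_asymp.
pose x (n : nat) : R := n%:R `^ (10^-1).
pose C : R := 2 * expR 3 + 1.
have x_n n : x n ^+ 10 = n%:R.
  by rewrite /x -powR_mulrn ?powR_ge0 // -powRrM mulVf // powRr1.
have x_cvg : (fun n => (x n)^-1) @ \oo --> (0 : R) by exact: cvg_inv_root.
(* [x ^+ 9 / n = x^-1]. *)
exists (fun n => x n ^+ 9); split.
  apply: cvg_trans x_cvg; apply: near_eq_cvg; near=> n.
  have n0 : (0 < n)%N by near: n; exact: nbhs_infty_gt.
  have x0 : 0 < x n by rewrite powR_gt0 // ltr0n.
  by rewrite -x_n; field; rewrite gt_eqF.
have lower : (fun n => 1 - C * ((x n)^-1 * (x n)^-1)) @ \oo --> (1 : R).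
  rewrite -[X in _ --> X](_ : 1 - C * (0 * 0) = 1); last by rewrite !mulr0 subr0.
  exact: cvgB (cvg_cst _) (cvgM (cvg_cst C) (cvgM x_cvg x_cvg)).
apply: (squeeze_cvgr (h := fun=> 1) _ lower); last exact: cvg_cst.
near=> n.
have n0 : (0 < n)%N by near: n; exact: nbhs_infty_gt.
have n1 : 1 <= n%:R :> R by rewrite ler1n.
have x1 : 1 <= x n.
  by rewrite -(@ler_pXn2r _ 10) ?nnegrE ?powR_ge0 // x_n expr1n.
have x0 : 0 < x n by apply: lt_le_trans x1.
have x_large : 2 * expR 3 <= x n ^+ 2.
  rewrite -(@ler_pXn2r _ 5) ?nnegrE ?mulr_ge0 ?expR_ge0 ?exprn_ge0 ?(ltW x0) //.
  rewrite -exprM x_n; near: n; exact: nbhs_infty_ger.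
have qmax_x : qmax (q n) <= x n ^- 9.
  have -> : qmax (q n) = n%:R `^ (-1 + eta n) by near: n.
  have -> : x n ^- 9 = n%:R `^ (- (9 / 10)).
    by rewrite powRN /x -powR_mulrn ?powR_ge0 // -powRrM; congr (_ `^ _)^-1; field.
  rewrite ler_powR //.
  have : `|eta n| <= 10^-1 by near: n; apply: cvgr0_norm_le.
  by move=> /(le_trans (ler_norm _)); lra.
have [qmin0 deg] : 0 < qmin (q n) /\
    Num.max (qmax (q n) / qmin (q n)) 154 + eps
      <= min_community_degree (V n) (q n) (s n) by near: n.
have deg' : Num.max (qmax (q n) / qmin (q n)) 154
    <= min_community_degree (V n) (q n) (s n).
  by apply: le_trans deg; rewrite lerDl ltW.
move: deg'; rewrite ge_max => /andP[ratio deg154].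
rewrite csbm_prob_le1 ?andbT //; last exact: edge_prob_range.
rewrite -expr2 exprVn.
exact: csbm_estimator_ge.
Unshelve. all: by end_near. Qed.
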